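(* For every positive integer $r$, the following statements hold. (a) For every integer $d\ge2$, every $(d(d+1)+2r)$-connected graph contains pairwise edge-disjoint spanning subgraphs $H,T_1,\ldots,T_r$, where $H$ is $d$-rigid and $T_1,\ldots,T_r$ are spanning trees. The connectivity bound is best possible: there exists a $(d(d+1)+2r-1)$-connected graph that does not contain such pairwise edge-disjoint spanning subgraphs $H,T_1,\ldots,T_r$. (b) For every positive integer $k$, every $(k(k+1)+2r)$-connected graph $G$ contains $r$ pairwise edge-disjoint spanning trees $T_1,\ldots,T_r$ such that $G-\bigcup_{i=1}^{r}E(T_i)$ is $k$-connected.
   Context: All graphs are finite and simple. For a positive integer $k$, a graph $G$ is $k$-connected if $|V(G)|\ge k+1$ and $G-S$ is connected for every $S\subseteq V(G)$ with $|S|<k$. For $F\subseteq E(G)$, $G-F=(V(G),E(G)\setminus F)$. Rigidity: let $K(V)$ be the complete graph on a finite vertex set $V$. A $d$-dimensional realization is a map $p:V\to\mathbb{R}^d$; it is generic if its $d|V|$ coordinates are algebraically independent over $\mathbb{Q}$. The rigidity matrix $R(G,p)$ of a graph $G$ on $V$ has one row for each edge $uv$ and $d$ columns for each vertex; the row of $uv$ has $p(u)-p(v)$ in the columns of $u$, $p(v)-p(u)$ in the columns of $v$, and zeros elsewhere. The $d$-dimensional generic rigidity matroid $\mathcal{R}_d(K(V))$ is the row matroid of $R(K(V),p)$ for generic $p$ (independent of the choice of generic $p$), and $r_d$ denotes its rank function. For a graph $H=(V,E_H)$ put $r_d(H)=r_d(E_H)$. The graph $H$ is $d$-rigid if $r_d(H)=r_d(K(V))$.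 *)

(* Defs.v *)
From mathcomp Require Import all_boot all_order all_algebra.
From mathcomp Require Import reals mpoly.
From mathcomp Require classical_sets.

Set Implicit Arguments.
Unset Strict Implicit.
Unset Printing Implicit Defensive.

Import GRing.Theory Num.Theory.

Local Open Scope ring_scope.

(* A graph on the vertex set V is given by its edge set E : {set {set V}}.
   Spanning subgraphs are then subsets of E, and G - F is E :\: F. *)

Definition simple_graph (V : finType) (E : {set {set V}}) : Prop :=
  forall e : {set V}, e \in E -> #|e| = 2%N.

Definition complete_graph (V : finType) : {set {set V}} :=
  [set e : {set V} | #|e| == 2%N].

Definition adj (V : finType) (E : {set {set V}}) : rel V :=
  fun u v => [set u; v] \in E.

(* Connectedness of the graph (W, E), where every edge in E lies inside W. *)
Definition connected_graph (V : finType) (W : {set V}) (E : {set {set V}}) :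
    Prop :=
  W != set0 /\
  forall u v : V, u \in W -> v \in W -> connect (adj E) u v.

Definition delete_vertices (V : finType) (E : {set {set V}}) (S : {set V}) :
    {set {set V}} :=
  [set e in E | [disjoint e & S]].

Definition k_connected (k : nat) (V : finType) (E : {set {set V}}) : Prop :=
  (k.+1 <= #|V|)%N /\
  forall S : {set V}, (#|S| < k)%N ->
    connected_graph (~: S) (delete_vertices E S).

(* For a simple graph, cycle sequences of size at most 2 are not cycles of the
   graph: they are empty, or traverse one edge back and forth. *)
Definition acyclic (V : finType) (E : {set {set V}}) : Prop :=
  forall c : seq V, uniq c -> cycle (adj E) c -> (size c <= 2)%N.

Definition spanning_tree (V : finType) (E T : {set {set V}}) : Prop :=
  [/\ T \subset E, connected_graph [set: V] T & acyclic T].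

Definition realization (R : realType) (V : finType) (d : nat) : Type :=
  {ffun V -> 'rV[R]_d}.

Definition coordinates (R : realType) (V : finType) (d : nat)
    (p : realization R V d) (b : 'I_#|{: V * 'I_d}|) : R :=
  p (enum_val b).1 0 (enum_val b).2.

Definition generic (R : realType) (V : finType) (d : nat)
    (p : realization R V d) : Prop :=
  forall P : {mpoly rat[#|{: V * 'I_d}|]},
    (map_mpoly (ratr : rat -> R) P).@[coordinates p] = 0 -> P = 0.

(* In the row of an edge e = {u, v}, the sum over x in e equals p u - p v in
   the columns of u, and p v - p u in those of v (the term x = w vanishes). *)
Definition rigidity_matrix (R : realType) (V : finType) (d : nat)
    (E : {set {set V}}) (p : realization R V d) :
    'M[R]_(#|E|, #|{: V * 'I_d}|) :=
  \matrix_(a < #|E|, b < #|{: V * 'I_d}|)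
    let e : {set V} := enum_val a in
    let w : V := (enum_val b).1 in
    let i : 'I_d := (enum_val b).2 in
    if w \in e then \sum_(x in e) (p w 0 i - p x 0 i) else 0.

(* The value does not depend on which generic p is selected; the default 0 is
   never used, since generic realizations exist over the real numbers. *)
Definition generic_realization (R : realType) (V : finType) (d : nat) :
    realization R V d :=
  classical_sets.xget [ffun=> 0] (@generic R V d).

Definition rigidity_rank (R : realType) (V : finType) (d : nat)
    (E : {set {set V}}) : nat :=
  \rank (rigidity_matrix E (generic_realization R V d)).

Definition rigid (R : realType) (V : finType) (d : nat) (H : {set {set V}}) :
    Prop :=
  rigidity_rank R d H = rigidity_rank R d (complete_graph V).

Definition disjoint_spanning_trees (V : finType) (r : nat) (E : {set {set V}})
    (T : 'I_r -> {set {set V}}) : Prop :=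
  (forall i : 'I_r, spanning_tree E (T i)) /\
  (forall i j : 'I_r, i != j -> [disjoint T i & T j]).

Definition has_rigid_tree_packing (R : realType) (V : finType) (d r : nat)
    (E : {set {set V}}) : Prop :=
  exists (H : {set {set V}}) (T : 'I_r -> {set {set V}}),
    [/\ H \subset E, rigid R d H, disjoint_spanning_trees E T
      & forall i : 'I_r, [disjoint H & T i]].

(* Main.v *)
(* Let d0 = d (d + 1). By matroid union it suffices that, for every set F of edges
   of the graph, |E \ F| + rk_d F + r rk_1 F is at least the sum of the ranks of the
   complete graph, where rk_1 is the graphic rank and F may be assumed to be flat in
   the d-dimensional rigidity matroid. Following Villanyi, rk_d F is bounded below by
   adding the vertices in a uniformly random order: a new vertex adds min(s, d) to
   the rank when it has s earlier neighbors, and d + 1 when s > d and these neighbors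
   do not form a clique of F (0- and 1-extensions). Since F is flat, this gives every
   vertex of degree at least d0 in F an expected increase of at least d, unless it
   is simplicial. The half-edges outside F pay for the other vertices and leave, by
   the connectivity of the graph, a surplus of at least r in each component of F.

   For the sharpness, every vertex of K_{m,m}, with m = d0 + 2 r - 1, is replaced by
   a clique of size m: the m^2 edges between the cliques are too few to join the
   2 m cliques into a rigid graph and r edge-disjoint trees. *)
Require Import Defs.
From mathcomp Require Import all_boot all_order all_algebra.
From mathcomp Require Import zify ring lra.
From mathcomp Require Import reals mpoly.
From mathcomp Require boolp classical_sets cardinality lebesgue_measure.

Set Implicit Arguments.
Unset Strict Implicit.
Unset Printing Implicit Defensive.

Import Order.TTheory GRing.Theory Num.Theory.

Local Open Scope ring_scope.

(** * Abstract rigidity matroids *)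

(** The whole argument is run for an arbitrary function satisfying [rigidity_axioms]. With [d = 1]
    the same record describes the graphic matroid, so the union combines instances of one notion,
    and genericity matters only when the axioms are checked. The constant [d (d + 1)] is a
    break-even point. A vertex with n > d neighbors in [F] has an expected increase that falls short
    of [d] by [d (d + 1) / (2 (n + 1))] if they form a clique; otherwise the bound is
    [d + 1/2 - d (d + 1) / (2 n)], which reaches [d] exactly at n = [d (d + 1)]. The additional
    [2 r] in the degree are half-edges, worth [r]. The obstacle is a simplicial vertex without edges
    outside [F]: its shortfall is paid by nobody. Such a vertex is deleted; put last in the ordering
    it adds a full [d] to the rank, and the connectivity survives because its neighborhood is a
    clique. Part (b) is the packing with [d = k], since a [d]-rigid graph on more than [d] vertices
    is [d]-connected: two cliques that share fewer than [d] vertices cannot reach full rank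
    together. *)

Definition clique_edges (V : finType) (A : {set V}) : {set {set V}} :=
  [set e in complete_graph V | e \subset A].

Definition star (V : finType) (v : V) (N : {set V}) : {set {set V}} :=
  [set [set v; x] | x in N].

Lemma mem_star (V : finType) (v x : V) (N : {set V}) :
  x \in N -> [set v; x] \in star v N.
Proof. exact: imset_f. Qed.

(* rk_star and rk_extension are the 0- and 1-extension properties; rk_stress says that
   K_{d+2} minus an edge spans that edge. *)
Record rigidity_axioms (V : finType) (d : nat) (rho : {set {set V}} -> nat) : Prop :=
  RigidityAxioms {
    rk_mono : forall F G : {set {set V}}, F \subset G -> (rho F <= rho G)%N;
    rk_submod : forall F G : {set {set V}},
      (rho (F :|: G) + rho (F :&: G) <= rho F + rho G)%N;
    rk_card : forall F : {set {set V}}, (rho F <= #|F|)%N;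
    rk_star : forall (F : {set {set V}}) (v : V) (M : {set V}),
      (forall e, e \in F -> v \notin e) -> v \notin M -> (#|M| <= d)%N ->
      (rho F + #|M| <= rho (F :|: star v M))%N;
    rk_extension : forall (F : {set {set V}}) (v : V) (M : {set V}) x y,
      (forall e, e \in F -> v \notin e) -> v \notin M -> #|M| = d.+1 ->
      x \in M -> y \in M -> x != y -> (rho F < rho ([set x; y] |: F))%N ->
      (rho F + d.+1 <= rho (F :|: star v M))%N;
    rk_stress : forall (F : {set {set V}}) (M : {set V}) x y, #|M| = d ->
      x \notin M -> y \notin M -> x != y ->
      (forall u w, u != w -> u \in [set x; y] :|: M -> w \in [set x; y] :|: M ->
         [set u; w] != [set x; y] -> [set u; w] \in F) ->
      (rho ([set x; y] |: F) <= rho F)%N;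
    rk_cut : forall (F : {set {set V}}) (A : {set V}) x y,
      (forall e, e \in F -> #|e| = 2%N) ->
      (forall u w, [set u; w] \in F -> u \in A -> w \in A) ->
      x \in A -> y \notin A -> (rho F < rho ([set x; y] |: F))%N }.

Lemma subset_of_card (T : finType) (A B : {set T}) (k : nat) :
  A \subset B -> (#|A| <= k <= #|B|)%N ->
  exists M : {set T}, [/\ A \subset M, M \subset B & #|M| = k].
Proof.
move=> sAB /andP[Ak kB]; have [m] := ubnP (k - #|A|).
elim: m A sAB Ak => // m IHm A sAB Ak lm.
have [kA|] := eqVneq #|A| k; first by exists A.
move=> neA; have ltA : (#|A| < k)%N by rewrite ltn_neqAle neA.
have [x xB xA] : exists2 x, x \in B & x \notin A.
  apply/subsetPn; apply: contraL ltA => /subset_leq_card BA; rewrite -leqNgt.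
  exact: leq_trans BA.
have cxA : #|x |: A| = #|A|.+1 by rewrite cardsU1 xA.
have [|||M [sM MB cM]] := IHm (x |: A); rewrite ?cxA //; last 2 first.
- by move: lm; lia.
- by exists M; split=> //; apply: subset_trans sM; apply: subsetUr.
by rewrite subUset sub1set xB.
Qed.

Section RankTheory.
Variables (V : finType) (d : nat) (rho : {set {set V}} -> nat).
Hypothesis rhoP : rigidity_axioms d rho.
Implicit Types (F G : {set {set V}}) (e A B M S W : {set V}).

Lemma rkU F G : (rho (F :|: G) <= rho F + rho G)%N.
Proof. exact: leq_trans (leq_addr _ _) (rk_submod rhoP F G). Qed.

Lemma rkU1_sub F G e : F \subset G -> (rho (e |: F) <= rho F)%N ->
  (rho (e |: G) <= rho G)%N.
Proof.
move=> sFG le_e; have := rk_submod rhoP (e |: F) G.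
have -> : e |: F :|: G = e |: G by rewrite -setUA (setUidPr sFG).
suff leF : (rho F <= rho ((e |: F) :&: G))%N.
  move=> le_sum; rewrite -(leq_add2r (rho F)).
  apply: leq_trans (leq_add (leqnn _) leF) (leq_trans le_sum _).
  by rewrite addnC leq_add2l.
by apply: (rk_mono rhoP); rewrite subsetI sFG subsetUr.
Qed.

Lemma rk_closure F G : (forall e, e \in G -> (rho (e |: F) <= rho F)%N) ->
  rho (F :|: G) = rho F.
Proof.
have [m] := ubnP #|G|; elim: m G => // m IHm G cG HG.
have [->|[e eG]] := set_0Vmem G; first by rewrite setU0.
rewrite -(setD1K eG) setUCA.
have IH : rho (F :|: (G :\ e)) = rho F.
  apply: IHm => [|f /setD1P [_ /HG] //].
  by move: cG; rewrite (cardsD1 e G) eG; lia.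
apply/eqP; rewrite eqn_leq; apply/andP; split.
  by rewrite -[leqRHS]IH; apply: (@rkU1_sub F); rewrite ?subsetUl ?HG.
by apply: (rk_mono rhoP); rewrite setUCA subsetUl.
Qed.

Lemma clique_edgesP A e :
  reflect (exists x y, [/\ x \in A, y \in A, x != y & e = [set x; y]])
          (e \in clique_edges A).
Proof.
rewrite !inE; apply: (iffP andP) => [[/cards2P [x [y [xy ->]]]]|[x [y [xA yA xy ->]]]].
  by rewrite subUset !sub1set => /andP[xA yA]; exists x, y.
by rewrite cards2 xy subUset !sub1set xA yA.
Qed.

Lemma mem_clique_edges A x y :
  ([set x; y] \in clique_edges A) = [&& x != y, x \in A & y \in A].
Proof. by rewrite !inE cards2 subUset !sub1set; case: (x != y). Qed.

Lemma clique_edgesS A B : A \subset B -> clique_edges A \subset clique_edges B.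
Proof.
move=> sAB; apply/subsetP => e; rewrite !inE => /andP[-> eA] /=.
exact: subset_trans sAB.
Qed.

Lemma clique_edgesU1 v A : v \notin A ->
  clique_edges (v |: A) = clique_edges A :|: star v A.
Proof.
move=> vA; apply/setP => e; apply/idP/idP => [/clique_edgesP [x [y [xA yA xy ->]]]|].
  rewrite inE mem_clique_edges xy /=.
  case/setU1P: xA xy => [->|xA] xy; case/setU1P: yA xy => [->|yA] xy.
  - by rewrite eqxx in xy.
  - by rewrite mem_star ?orbT.
  - by rewrite setUC mem_star ?orbT.
  - by rewrite xA yA.
case/setUP => [|/imsetP [x xA ->]].
  by apply/subsetP/clique_edgesS/subsetUr.
rewrite mem_clique_edges !inE eqxx xA orbT !andbT.
by apply: contraNneq vA => ->.
Qed.

Lemma notin_clique_edges v A e : v \notin A -> e \in clique_edges A -> v \notin e.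
Proof. by move=> vA; rewrite !inE => /andP[_ /subsetP sA]; apply: contra vA => /sA. Qed.

Lemma card_star v A : (#|star v A| <= #|A|)%N.
Proof. exact: leq_imset_card. Qed.

(** A vertex added to a clique on j vertices raises the rank by [minn j d]: at least so much by
    [rk_star], and no more because once [d] of its edges are present, each further one completes a
    [K_{d+2}] and is spanned by [rk_stress]. *)
Lemma rk_clique A : rho (clique_edges A) = (\sum_(j < #|A|) minn j d)%N.
Proof.
have [m] := ubnP #|A|; elim: m A => // m IHm A cA.
have [->|[v vA]] := set_0Vmem A.
  rewrite cards0 big_ord0; apply/eqP; rewrite -leqn0.
  apply: leq_trans (rk_card rhoP _) _; rewrite leqn0 cards_eq0.
  apply/eqP/setP => e; rewrite !inE subset0.
  by apply/negP => /andP[/eqP c2 /eqP e0]; rewrite e0 cards0 in c2.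
pose B := A :\ v; have vB : v \notin B by rewrite !inE eqxx.
have AE : A = v |: B by rewrite setD1K.
have cAB : #|A| = #|B|.+1 by rewrite AE cardsU1 vB.
rewrite AE clique_edgesU1 // -AE cAB big_ord_recr /= -IHm; last by rewrite -ltnS -cAB.
have vF e := @notin_clique_edges v B e vB.
have [|M [_ sMB cM]] := @subset_of_card _ set0 B (minn #|B| d) (sub0set _).
- by rewrite cards0 geq_minl.
have vM : v \notin M by apply: contra vB => /(subsetP sMB).
have sM : star v M \subset star v B by apply: imsetS.
apply/eqP; rewrite eqn_leq; apply/andP; split; last first.
  rewrite -cM; apply: leq_trans (rk_star rhoP vF vM _) _; first by rewrite cM geq_minr.
  by apply: (rk_mono rhoP); rewrite setUS.
have [Bd|dB] := leqP #|B| d.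
  apply: leq_trans (rkU _ _) _; rewrite leq_add2l (leq_trans (rk_card rhoP _)) //.
  exact: card_star.
have -> : clique_edges B :|: star v B = (clique_edges B :|: star v M) :|: star v B.
  by rewrite -setUA (setUidPr sM).
rewrite rk_closure.
  apply: leq_trans (rkU _ _) _; rewrite leq_add2l (leq_trans (rk_card rhoP _)) //.
  by rewrite (leq_trans (card_star _ _)) // cM; lia.
move=> e /imsetP [x xB ->].
have [xM|xM] := boolP (x \in M).
  by rewrite (setUidPr _) // sub1set inE mem_star ?orbT.
apply: (rk_stress rhoP (M := M)) => //; first by rewrite cM; lia.
  by apply: contraNneq vB => ->.
have inB u : u \in [set v; x] :|: M -> u != v -> u \in B.
  by case/setUP => [/set2P [->|->]|/(subsetP sMB)] //; rewrite eqxx.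
have aux u w : u != w -> u \in [set v; x] :|: M -> w \in [set v; x] :|: M -> w != v ->
   [set u; w] != [set v; x] -> [set u; w] \in clique_edges B :|: star v M.
  move=> uw uS wS wv ne; have [uv|uv] := eqVneq u v.
    rewrite uv in ne *; suff wM : w \in M by rewrite inE mem_star ?orbT.
    by case/setUP: wS => [/set2P [wv'|wx]|//]; 
      [rewrite wv' eqxx in wv|rewrite wx eqxx in ne].
  by rewrite inE mem_clique_edges uw !inB.
move=> u w uw uS wS; have [wv|wv] := eqVneq w v; last exact: aux.
by rewrite setUC; apply: aux => //; rewrite -?wv // eq_sym.
Qed.

(** For a rank function satisfying the axioms, the case [G = F] implies the others; every [G] is
    allowed because [rank_last] needs the condition for induced subgraphs of [F]. *)
Definition flat F : Prop :=
  F \subset complete_graph V /\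
  forall G e, G \subset F -> #|e| = 2%N -> (rho (e |: G) <= rho G)%N -> e \in F.

Definition rclosure F : {set {set V}} :=
  [set e in complete_graph V | (rho (e |: F) <= rho F)%N].

Lemma sub_rclosure F : F \subset complete_graph V -> F \subset rclosure F.
Proof.
move/subsetP=> sF; apply/subsetP => e eF; rewrite inE sF //=.
by rewrite (setUidPr _) // sub1set.
Qed.

Lemma rk_rclosure F : F \subset complete_graph V -> rho (rclosure F) = rho F.
Proof.
move=> sF; rewrite -(setUidPr (sub_rclosure sF)); apply: rk_closure => e.
by rewrite inE => /andP[].
Qed.

Lemma flat_rclosure F : F \subset complete_graph V -> flat (rclosure F).
Proof.
move=> sF; split; first by apply/subsetP => e; rewrite inE => /andP[].
move=> G e sG e2 le_e; rewrite inE inE e2 eqxx /=.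
have := rkU1_sub sG le_e; rewrite rk_rclosure //; apply: leq_trans.
by apply: (rk_mono rhoP); rewrite setUS // sub_rclosure.
Qed.

(** For [a] in [A] outside a [d]-subset of [M], all edges among [x], [a] and that subset except [xa]
    lie in [F], so [rk_stress] and flatness put [xa] into [F]. *)
Lemma flat_clique F A M x : flat F -> clique_edges A \subset F ->
  M \subset A -> (d <= #|M|)%N -> (forall y, y \in M -> [set x; y] \in F) ->
  clique_edges (x |: A) \subset F.
Proof.
move=> flatF cliA sMA dM xMF.
have [xA|xA] := boolP (x \in A); first by rewrite (setUidPr _) // sub1set.
have [|M' [_ sM' cM']] := @subset_of_card _ set0 M d (sub0set _).
  by rewrite cards0.
have M'A : M' \subset A by apply: subset_trans sMA.
rewrite clique_edgesU1 // subUset cliA; apply/subsetP => _ /imsetP [a aA ->].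
have [aM|aM] := boolP (a \in M'); first by apply/xMF/(subsetP sM').
have xa : x != a by apply: contraNneq xA => ->.
have [_ /(_ F [set x; a])] := flatF; apply; rewrite ?cards2 ?xa //.
apply: (rk_stress rhoP (M := M')) => //.
  by apply: contra xA => /(subsetP M'A).
have inA u : u \in [set x; a] :|: M' -> u != x -> u \in A.
  by case/setUP => [/set2P [->|->]|/(subsetP M'A)] //; rewrite eqxx.
have aux u w : u != w -> u \in [set x; a] :|: M' -> w \in [set x; a] :|: M' ->
    w != x -> [set u; w] != [set x; a] -> [set u; w] \in F.
  move=> uw uS wS wx; have [->|ux] := eqVneq u x => ne.
    apply/xMF/(subsetP sM'); case/setUP: wS => [/set2P [wx'|wa]|//].
      by rewrite wx' eqxx in wx.
    by rewrite wa eqxx in ne.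
  by apply: (subsetP cliA); rewrite mem_clique_edges uw !inA.
move=> u w uw uS wS; have [wx|] := eqVneq w x; last exact: aux.
by rewrite setUC; apply: aux => //; rewrite -?wx // eq_sym.
Qed.

End RankTheory.

(** * The rank of a flat, by random vertex orderings *)

Definition neighbors (V : finType) (E : {set {set V}}) (W : {set V}) (v : V) :
    {set V} :=
  [set x in W | [set v; x] \in E].

Definition induced (V : finType) (E : {set {set V}}) (W : {set V}) :
    {set {set V}} :=
  [set e in E | e \subset W].

Section OrderBound.
Variables (V : finType) (d : nat) (rho : {set {set V}} -> nat).
Hypothesis rhoP : rigidity_axioms d rho.
Hypothesis d_gt0 : (0 < d)%N.
Variable F : {set {set V}}.
Hypothesis flatF : flat rho F.
Implicit Types (A B M S W : {set V}).

Let cliq S := clique_edges S \subset F.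

(** In a random ordering the number j of earlier neighbors is uniform on 0, ..., s, and
    [clique_bound s] is the mean of min(j, d). [nonclique_bound s] is the mean increase in the
    extremal case in which one vertex x leaves a clique when removed: the earlier neighbors contain
    x with probability j / s, and for j > d this earns 1 more. *)
Definition clique_bound (s : rat) : rat := d%:R - d%:R * (d%:R + 1) / (2 * (s + 1)).
Definition nonclique_bound (s : rat) : rat :=
  d%:R + 1 / 2 - d%:R * (d%:R + 1) / (2 * s).

(* A lower bound for the expected increase of the rank when a vertex with
   neighborhood S is added at its place in a uniformly random vertex ordering *)
Definition order_weight S : rat :=
  if (#|S| <= d)%N then #|S|%:R / 2
  else if cliq S then clique_bound #|S|%:R else nonclique_bound #|S|%:R.

Definition last_weight S : nat :=
  if (#|S| <= d)%N then #|S| else if cliq S then d else d.+1.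

(** At size [d] all three formulas equal [d / 2], so the bounds may be used from [d] on. The
    recursion from size [d + 1] down to [d] relies on this. *)
Lemma order_weightE S : (d <= #|S|)%N ->
  order_weight S = if cliq S then clique_bound #|S|%:R else nonclique_bound #|S|%:R.
Proof.
move=> dS; rewrite /order_weight; case: leqP => // Sd.
have -> : #|S| = d by apply/eqP; rewrite eqn_leq Sd.
have d0 : d%:R != 0 :> rat by rewrite pnatr_eq0 -lt0n.
have d1 : d%:R + 1 != 0 :> rat by rewrite natr1 pnatr_eq0.
by case: ifP => _; rewrite /clique_bound /nonclique_bound; field.
Qed.

Lemma flatF_edge (u v : V) : [set u; v] \in F -> u != v.
Proof.
have [/subsetP sF _] := flatF; move/sF; rewrite inE cards2.
by case: (u != v).
Qed.

(** The vertex [u] together with [S :\ y] is a clique, and [y] is joined in [F] to [u] and to [S]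
    without [x] and [y], at least [d] vertices of that clique; [flat_clique] supplies [xy]. *)
Lemma cliq_two S (u x y : V) : u \notin S -> (forall z, z \in S -> [set u; z] \in F) ->
  (d < #|S|)%N -> x \in S -> y \in S -> x != y ->
  cliq (S :\ x) -> cliq (S :\ y) -> cliq S.
Proof.
move=> uS uF dS xS yS xy cx cy.
pose A := u |: (S :\ y).
have cA : cliq A.
  have uSy : u \notin S :\ y by rewrite inE negb_and uS orbT.
  rewrite /cliq clique_edgesU1 // subUset; apply/andP; split=> //.
  apply/subsetP => _ /imsetP [z zS ->].
  by apply: uF; case/setD1P: zS.
pose M := u |: (S :\ x :\ y).
have : cliq (y |: A).
  apply: (flat_clique rhoP flatF cA (M := M)).
  - by apply: setUS; apply: setSD; apply: subD1set.
  - rewrite cardsU1 !inE negb_and (negPf uS) andbF /= orbT /=.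
    move: dS; rewrite (cardsD1 x S) xS (cardsD1 y (S :\ x)) !inE yS eq_sym xy /=.
    by lia.
  move=> z /setU1P [->|]; first by rewrite setUC; apply: uF.
  case/setD1P => zy zx; apply: (subsetP cx); rewrite mem_clique_edges eq_sym zy zx.
  by rewrite !inE eq_sym xy yS.
apply: subset_trans; apply: clique_edgesS; apply/subsetP => z zS.
by rewrite !inE zS andbT; case: eqP => //= _; rewrite orbT.
Qed.

(** This conditions on which of the [#|S| + 1] vertices of [u |: S] comes last: [u] itself, which
    then sees all of [S], or some [x], which [u] does not see. *)
Lemma order_weight_rec S (u : V) : u \notin S -> (forall z, z \in S -> [set u; z] \in F) ->
  (#|S|%:R + 1) * order_weight S <=
    (last_weight S)%:R + \sum_(x in S) order_weight (S :\ x).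
Proof.
move=> uS uF; set s := #|S|.
have cD x : x \in S -> #|S :\ x| = s.-1 by rewrite /s (cardsD1 x S) => ->.
have [Sd|dS] := leqP s d.
  rewrite /order_weight /last_weight -/s Sd.
  rewrite (eq_bigr (fun=> s.-1%:R / 2)); last first.
    move=> x xS; rewrite cD // (_ : (s.-1 <= d)%N) //.
    by apply: leq_trans Sd; apply: leq_pred.
  rewrite sumr_const -/s; case: (s) => [|n] /=; first by rewrite mul0r mulr0 mulr0n addr0.
  rewrite -mulr_natr -!natr1 le_eqVlt; apply/orP; left; apply/eqP; by field.
have s_gt0 : (0 < s)%N by apply: leq_ltn_trans dS.
have dD x : x \in S -> (d <= #|S :\ x|)%N by move/cD ->; rewrite -ltnS prednK.
have sE : s%:R = s.-1%:R + 1 :> rat by rewrite natr1 prednK.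
have t1 : d%:R <= s.-1%:R :> rat by rewrite ler_nat -ltnS prednK.
have d1 : 1 <= d%:R :> rat by rewrite ler1n.
have sumc (c : rat) : \sum_(x in S) c = s%:R * c by rewrite sumr_const mulr_natl.
rewrite order_weightE; last exact: ltnW.
rewrite /last_weight -/s [(s <= d)%N]leqNgt dS /=.
set t : rat := s.-1%:R in sE t1; set D : rat := d%:R in t1 d1 *.
have t0 : t != 0 by lra.
have t10 : t + 1 != 0 by lra.
have t20 : t + 2 != 0 by lra.
have [cS|ncS] := boolP (cliq S).
  rewrite (eq_bigr (fun=> clique_bound t)); last first.
    move=> x xS; rewrite order_weightE ?dD // cD // (_ : cliq _) //.
    by apply: subset_trans cS; apply: clique_edgesS; apply: subD1set.
  rewrite sumc sE /clique_bound -/D le_eqVlt; apply/orP; left; apply/eqP; field.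
  rewrite -/t; lra.
have key : (t + 1 + 1) * nonclique_bound (t + 1) <=
    D + 1 + (t + 1) * nonclique_bound t.
  rewrite /nonclique_bound -/D -subr_ge0.
  rewrite (_ : _ - _ = (t * (t + 1) - D * (D + 1)) / (2 * t * (t + 1))); last by field; lra.
  by rewrite divr_ge0 // ?mulr_ge0; nra.
rewrite -natr1 sE -/D.
(* By [cliq_two] at most one [S :\ x] is a clique. If none is, [key] suffices; if exactly one is,
   the recursion holds with equality. *)
have [none|] := boolP [forall x in S, ~~ cliq (S :\ x)].
  rewrite (eq_bigr (fun=> nonclique_bound t)) ?sumc ?sE // => x xS.
  by rewrite order_weightE ?dD // cD // (negPf (forall_inP none x xS)).
rewrite negb_forall => /existsP [x0]; rewrite negb_imply negbK => /andP[x0S cx0].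
rewrite (big_setD1 x0) //= (eq_bigr (fun=> nonclique_bound t)); last first.
  move=> x /setD1P [xx0 xS]; rewrite order_weightE ?dD // cD //.
  by case: ifP => // cx; rewrite (cliq_two uS uF dS x0S xS) // eq_sym in ncS.
rewrite order_weightE ?dD // cx0 cD // -/t sumr_const cD // -mulr_natl -/t.
rewrite /clique_bound /nonclique_bound -/D le_eqVlt; apply/orP; left; apply/eqP.
by field; lra.
Qed.

Lemma neighborsD1 (E : {set {set V}}) W (u v : V) :
  neighbors E (W :\ u) v = neighbors E W v :\ u.
Proof. by apply/setP => x; rewrite !inE andbA. Qed.

Lemma notin_neighbors W v : v \notin neighbors F W v.
Proof. by rewrite inE negb_and; apply/orP; right; apply/negP => /flatF_edge; rewrite eqxx. Qed.

Lemma rank_last W u : u \in W ->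
  (rho (induced F (W :\ u)) + last_weight (neighbors F W u) <= rho (induced F W))%N.
Proof.
move=> uW; set S := neighbors F W u.
have uS : u \notin S by apply: notin_neighbors.
have avoid e : e \in induced F (W :\ u) -> u \notin e.
  by rewrite inE => /andP[_ /subsetP sW]; apply/negP => /sW; rewrite !inE eqxx.
have sub M : M \subset S -> induced F (W :\ u) :|: star u M \subset induced F W.
  move/subsetP => sMS; apply/subsetP => e /setUP [|/imsetP [x /sMS + ->]].
    by rewrite !inE => /andP[-> /= /subset_trans -> //]; apply: subD1set.
  by rewrite !inE => /andP[xW ->]; rewrite subUset !sub1set uW xW.
have small k : (k <= d)%N -> (k <= #|S|)%N ->
    (rho (induced F (W :\ u)) + k <= rho (induced F W))%N.
  move=> kd kS; have [|M [_ sM cM]] := @subset_of_card _ set0 S k (sub0set _).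
    by rewrite cards0.
  rewrite -cM; apply: leq_trans (rk_mono rhoP (sub M sM)).
  by apply: (rk_star rhoP) => //; [apply: contra uS => /(subsetP sM)|rewrite cM].
rewrite /last_weight; have [Sd|dS] := leqP #|S| d; first exact: small.
have [cS|/subsetPn [e /clique_edgesP [x [y [xS yS xy ->]]] exy]] := boolP (cliq S).
  by apply: small => //; apply: ltnW.
have [||M [sxy sM cM]] := @subset_of_card _ [set x; y] S d.+1.
- by rewrite subUset !sub1set xS yS.
- by rewrite cards2 xy dS !ltnS d_gt0.
have [xM yM] : x \in M /\ y \in M.
  by split; apply: (subsetP sxy); rewrite !inE eqxx ?orbT.
apply: leq_trans (rk_mono rhoP (sub M sM)).
apply: (rk_extension rhoP _ _ cM xM yM xy) => //; first by apply: contra uS => /(subsetP sM).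
(* The edge [xy] is missing from the flat [F], so no subset of [F] spans it and the 1-extension
   applies. *)
rewrite ltnNge; apply: contra exy => le_e; have [_ H] := flatF.
apply: H le_e; last by rewrite cards2 xy.
by apply/subsetP => f; rewrite inE => /andP[].
Qed.

(** Averaging over the last vertex [u] replaces the probability space: [rank_last] bounds its
    increase, and induction handles [W :\ u]. For a fixed [v], a [u] that is not adjacent to [v]
    leaves its weight unchanged, while the cases [u = v] and [u] in [N v] add up to
    [order_weight_rec]. *)
Lemma order_bound W :
  \sum_(v in W) order_weight (neighbors F W v) <= (rho (induced F W))%:R.
Proof.
have [m] := ubnP #|W|; elim: m W => // m IHm W cW.
have [->|[w wW]] := set_0Vmem W; first by rewrite big_set0 ler0n.
have W_gt0 : 0 < #|W|%:R :> rat by rewrite ltr0n (cardD1 w) wW.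
rewrite -(ler_pM2l W_gt0).
pose N v := neighbors F W v.
have step u : u \in W -> \sum_(v in W | v != u) order_weight (N v :\ u) +
    (last_weight (N u))%:R <= (rho (induced F W))%:R.
  move=> uW; apply: le_trans (_ : (rho (induced F (W :\ u)) + last_weight (N u))%:R <= _).
    rewrite natrD lerD2r; apply: le_trans (IHm (W :\ u) _).
      rewrite le_eqVlt; apply/orP; left; apply/eqP.
      by apply: eq_big => [v|v _]; rewrite ?neighborsD1 // !inE andbC.
    by move: cW; rewrite (cardsD1 u W) uW.
  by rewrite ler_nat rank_last.
apply: le_trans (_ : \sum_(u in W) (\sum_(v in W | v != u) order_weight (N v :\ u) +
    (last_weight (N u))%:R) <= _); last first.
  by rewrite mulr_natl -sumr_const; apply: ler_sum.
rewrite big_split /= mulr_sumr (exchange_big_dep (mem W)) /=; last by move=> u v _ /andP[].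
rewrite -big_split; apply: ler_sum => v vW /=.
have vN : v \notin N v by apply: notin_neighbors.
have NW : (W :\ v) :&: N v = N v.
  apply/setIidPr/subsetP => x xN; rewrite in_setD1; apply/andP; split.
    by apply: contraNneq vN => xv; rewrite -{1}xv.
  by move: xN; rewrite inE => /andP[].
rewrite (eq_bigl (fun u => u \in W :\ v)) => [|u]; last first.
  by rewrite !inE vW andbC eq_sym.
rewrite (big_setID (N v)) NW /=.
rewrite [X in _ + X + _](eq_bigr (fun=> order_weight (N v))); last first.
  move=> x /setDP[_ xN]; congr order_weight; apply/setP => y; rewrite in_setD1.
  by case: eqP => //= ->; rewrite (negPf xN).
rewrite sumr_const -[_ *+ _]mulr_natl.
have vF z : z \in N v -> [set v; z] \in F by rewrite inE => /andP[].
have := order_weight_rec vN vF.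
have -> : #|W|%:R = #|N v|%:R + 1 + #|(W :\ v) :\: N v|%:R :> rat.
  rewrite natr1 -natrD; congr (_%:R).
  by rewrite (cardsD1 v W) vW -(cardsID (N v) (W :\ v)) NW; lia.
rewrite -/(N v); lra.
Qed.

End OrderBound.

(** * Flats in highly connected graphs *)

(** Connectivity is relative to [W] so that vertices can be deleted while the type [V] stays
    fixed. *)
Definition connected_on (V : finType) (m : nat) (W : {set V}) (E : {set {set V}}) : Prop :=
  [/\ (m < #|W|)%N, E \subset clique_edges W
    & forall S : {set V}, (#|S| < m)%N -> forall u v, u \in W :\: S -> v \in W :\: S ->
        connect (adj (delete_vertices E S)) u v].

Lemma adj_sym (V : finType) (E : {set {set V}}) : ssrbool.symmetric (adj E).
Proof. by move=> x y; rewrite /adj setUC. Qed.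

Lemma connect_adj_sym (V : finType) (E : {set {set V}}) : connect_sym (adj E).
Proof. exact/sym_connect_sym/adj_sym. Qed.

Lemma connect_adjS (V : finType) (E E' : {set {set V}}) x y : E \subset E' ->
  connect (adj E) x y -> connect (adj E') x y.
Proof.
by move=> /subsetP sE; apply: connect_sub => u v uv; apply/connect1/sE.
Qed.

Lemma connect_adj_induced (V : finType) (E : {set {set V}}) (W : {set V}) x y :
  connect (adj (induced E W)) x y -> (x \in W) = (y \in W).
Proof.
apply: closed_connect => u v; rewrite /adj inE subUset !sub1set.
by case/andP=> _ /andP[-> ->].
Qed.

Lemma sum_minn_lt (k d : nat) :
  (0 < k)%N -> (0 < d)%N -> (\sum_(j < k) minn j d < k * d)%N.
Proof.
case: k => // k _ d_gt0; elim: k => [|k IHk]; first by rewrite big_ord1 mul1n min0n.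
by rewrite big_ord_recr /= mulSn addnC -addnS; apply: leq_add; rewrite ?geq_minr.
Qed.

Section Connectivity.
Variables (V : finType) (m : nat) (W : {set V}) (E : {set {set V}}).
Hypothesis connW : connected_on m W E.

Lemma connected_on_edge u v : [set u; v] \in E -> [/\ u != v, u \in W & v \in W].
Proof.
by have [_ /subsetP sE _] := connW; move/sE; rewrite mem_clique_edges => /and3P[].
Qed.

Lemma connected_on_degree v : v \in W -> (m <= #|neighbors E W v|)%N.
Proof.
move=> vW; rewrite leqNgt; apply/negP => ltS; have [mW _ H] := connW.
set S := neighbors E W v in ltS.
have vS : v \notin S.
  by rewrite inE negb_and; apply/orP; right; apply/negP => /connected_on_edge []; rewrite eqxx.
have [w wW] : exists2 w, w \in W & w \notin v |: S.
  apply/subsetPn; apply: contraL mW => /subset_leq_card WS; rewrite -leqNgt.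
  by apply: leq_trans WS _; rewrite cardsU1 vS.
rewrite in_setU1 negb_or => /andP[wv wS].
have /connectP [[|x p] /=] : connect (adj (delete_vertices E S)) v w.
- by apply: H => //; rewrite inE ?vW ?wW ?vS ?wS.
- by move=> _ Ew; rewrite Ew eqxx in wv.
case/andP=> + _ _; rewrite /adj inE => /andP[vx]; rewrite disjoints_subset subUset => /andP[_].
rewrite sub1set inE; case/negP; rewrite inE vx andbT.
by have [] := connected_on_edge vx.
Qed.

(** A path through [v] can take the edge of [E] between the neighbors before and after [v]. *)
Lemma connected_on_delete v : v \in W -> (m.+1 < #|W|)%N ->
  clique_edges (neighbors E W v) \subset E ->
  connected_on m (W :\ v) (induced E (W :\ v)).
Proof.
move=> vW mW cN; have [_ sE H] := connW; split.
- by rewrite (cardsD1 v W) vW in mW.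
- apply/subsetP => e; rewrite inE => /andP[/(subsetP sE)].
  by rewrite !inE => /andP[-> _] ->.
move=> S Sm u w; rewrite !inE => /and3P[uS uv uW] /and3P[wS wv wW].
set e2 := adj _.
have /connectP [p pp Ew] : connect (adj (delete_vertices E S)) u w.
  by apply: H; rewrite // inE ?uS ?wS.
have e2E x y : e2 x y = [&& [set x; y] \in E, x != v, y != v, x \notin S & y \notin S].
  rewrite /e2 /adj /delete_vertices /induced.
  rewrite inE inE disjoints_subset !subUset !sub1set !inE.
  case xyE: (_ \in E) => //=; have [xy -> ->] := connected_on_edge xyE.
  by case: (x == v); case: (y == v); case: (x \in S); case: (y \in S).
(* While the path sits at [v], the invariant remembers a surviving neighbor of [v] that is already
   reached; the next vertex is adjacent or equal to it. *)
pose inv x := if x == v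
  then exists2 y, [set v; y] \in E /\ (y \notin S) & connect e2 u y
  else connect e2 u x.
have inv_step x y : inv x -> adj (delete_vertices E S) x y -> inv y.
  rewrite /adj inE disjoints_subset subUset !sub1set !inE.
  move=> + /and3P[xyE xS yS]; have [xy _ _] := connected_on_edge xyE.
  rewrite /inv; case: eqP => [xv|/eqP xv]; case: eqP => [yv|/eqP yv].
  - by rewrite xv yv eqxx in xy.
  - case=> z [vz zS] uz; have [<-//|zy] := eqVneq z y.
    apply: connect_trans uz (connect1 _); rewrite e2E yv zS yS /= !andbT.
    have [vz' _ zW] := connected_on_edge vz; rewrite eq_sym vz' andbT.
    apply: (subsetP cN); rewrite mem_clique_edges zy !inE zW vz.
    by have [_ _ ->] := connected_on_edge xyE; rewrite -xv.
  - by move=> ux; exists x => //; rewrite setUC -yv.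
  by move=> ux; apply: connect_trans ux (connect1 _); rewrite e2E xyE xv yv xS.
have : inv u by rewrite /inv (negPf uv).
suff /(_ u pp) : forall x, path (adj (delete_vertices E S)) x p -> inv x -> inv (last x p).
  by rewrite -Ew /inv (negPf wv).
elim: (p) => [|y q IHq] x //= /andP[xy yq] ix.
by apply: IHq => //; apply: inv_step xy.
Qed.

End Connectivity.

(** * Slack: what a vertex earns in excess of [d] *)

Section Main.
Variables (V : finType) (d r : nat) (rho : {set {set V}} -> nat).
Hypothesis rhoP : rigidity_axioms d rho.
Hypothesis d_gt0 : (0 < d)%N.
Variable F : {set {set V}}.
Hypothesis flatF : flat rho F.

Let D0 := (d * (d + 1))%N.
Let cliq (S : {set V}) := clique_edges S \subset F.

Section Slack.
Variables (W : {set V}) (E : {set {set V}}).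
Hypothesis connW : connected_on (D0 + 2 * r) W E.
Hypothesis sFE : induced F W \subset E.

Let N v := neighbors F W v.
Let nF v := #|neighbors (E :\: F) W v|.

Definition slack v : rat := order_weight d F (N v) + (nF v)%:R / 2 - d%:R.

Lemma sub_induced : E \subset clique_edges W.
Proof. by case: connW. Qed.

Lemma degree_bound v : v \in W -> (D0 + 2 * r <= #|N v| + nF v)%N.
Proof.
move=> vW; apply: leq_trans (connected_on_degree connW vW) _.
rewrite /nF; apply: leq_trans (_ : #|N v :|: neighbors (E :\: F) W v| <= _)%N; last first.
  by rewrite cardsU leq_subr.
apply/subset_leq_card/subsetP => x; rewrite !inE => /andP[-> ->].
by rewrite andbT; case: (_ \in F).
Qed.

Lemma handshake : (\sum_(v in W) nF v <= 2 * #|E :\: F|)%N.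
Proof.
have E2 e : e \in E -> #|e| = 2%N.
  by move/(subsetP sub_induced); rewrite !inE => /andP[/eqP].
have le v : (nF v <= \sum_(e in E :\: F) (v \in e))%N.
  rewrite (eq_bigr (fun e : {set V} => if v \in e then 1 else 0)%N); last first.
    by move=> e _; case: (v \in e).
  rewrite -big_mkcondr /= sum1dep_card /nF -(card_in_imset (f := fun x => [set v; x])).
    apply/subset_leq_card/subsetP => _ /imsetP [x + ->]; rewrite !inE => /andP[_ /andP[vxF vx]].
    by rewrite vxF vx eqxx.
  move=> x y; rewrite inE => /andP[_ /setDP[vx _]] _ /setP/(_ x).
  have [xv _ _] := connected_on_edge connW vx.
  by rewrite !inE eqxx orbT eq_sym (negPf xv) => /esym/eqP.
apply: leq_trans (_ : \sum_(v in W) \sum_(e in E :\: F) (v \in e) <= _)%N.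
  exact: leq_sum.
rewrite exchange_big mulnC -sum_nat_const; apply: leq_sum => e /setDP[eE _].
rewrite -(E2 e eE) -sum1_card big_mkcond [leqRHS]big_mkcond; apply: leq_sum => v _.
by case: (v \in W); case: (v \in e).
Qed.

Let D0E : D0%:R = d%:R * (d%:R + 1) :> rat.
Proof. by rewrite /D0 natrM natrD. Qed.

Let d_ge1 : 1 <= d%:R :> rat.
Proof. by rewrite ler1n. Qed.

Let dD0 : (d < D0)%N.
Proof. by rewrite /D0; nia. Qed.

(** Let n be the degree of [v] in [F]. At least [D0 + 2 r - n] half-edges at [v] lie outside [F].
    For n > d the weight falls short of [d] by at most [D0 / (2 (n + 1))], which is at most
    [(D0 - n) / 2] because [n (D0 - n - 1) >= 0]; this leaves [r]. *)
Lemma slack_low v : v \in W -> (#|N v| < D0)%N -> r%:R <= slack v.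
Proof.
move=> vW ltD; have := degree_bound vW.
rewrite -(ler_nat rat) 2!natrD D0E natrM => deg.
have {}ltD : #|N v|%:R + 1 <= D0%:R :> rat by rewrite natr1 ler_nat.
rewrite D0E in ltD; rewrite /slack.
set n : rat := #|N v|%:R in ltD deg *; set s : rat := (nF v)%:R in deg *.
have n0 : 0 <= n by rewrite ler0n.
have [nd|dn] := leqP #|N v| d.
  (* Here the weight is n / 2, and the slack is at least
     [r + (D0 - 2 d) / 2 = r + d (d - 1) / 2]. *)
  have dd : 0 <= (d%:R - 1) * d%:R :> rat by rewrite mulr_ge0 ?subr_ge0.
  rewrite /order_weight nd -/n. lra.
have {}dn : d%:R < n by rewrite ltr_nat.
have n_gt0 : 0 < n by apply: le_lt_trans dn; apply: ler0n.
have n1 : n != 0 by rewrite gt_eqF.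
have n2 : n + 1 != 0 by rewrite gt_eqF // addr_gt0.
have le_c : clique_bound d n <= order_weight d F (N v).
  rewrite order_weightE // -/n; last by rewrite ltnW // -(ltr_nat rat).
  case: ifP => // _; rewrite -subr_ge0 /clique_bound /nonclique_bound.
  rewrite (_ : _ - _ = (n * (n + 1) - d%:R * (d%:R + 1)) / (2 * n * (n + 1))); last first.
    by field; rewrite n1 n2.
  apply: divr_ge0; last by rewrite !mulr_ge0 ?addr_ge0.
  rewrite (_ : _ - _ = (n - d%:R) * (n + d%:R + 1)); last by ring.
  by rewrite mulr_ge0 ?subr_ge0 ?addr_ge0 // ltW.
have : d%:R * (d%:R + 1) / (2 * (n + 1)) <= (d%:R * (d%:R + 1) - n) / 2.
  rewrite ler_pdivrMr ?mulr_gt0 ?addr_gt0 // -subr_ge0.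
  rewrite (_ : _ - _ = n * (d%:R * (d%:R + 1) - (n + 1))); last by field.
  by rewrite mulr_ge0 ?subr_ge0.
by move: le_c; rewrite /clique_bound; lra.
Qed.

Lemma slackE v : (D0 <= #|N v|)%N -> slack v =
  if cliq (N v) then ((nF v)%:R - D0%:R / (#|N v|%:R + 1)) / 2
  else (1 + (nF v)%:R - D0%:R / #|N v|%:R) / 2.
Proof.
move=> leD; have dN : (d < #|N v|)%N by apply: leq_trans leD.
rewrite /slack (order_weightE d_gt0 _ (ltnW dN)).
have n0 : #|N v|%:R != 0 :> rat by rewrite pnatr_eq0 -lt0n (leq_ltn_trans _ dN).
have n1 : #|N v|%:R + 1 != 0 :> rat by rewrite natr1 pnatr_eq0.
rewrite /cliq D0E; case: ifP => _; rewrite /clique_bound /nonclique_bound; by field.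
Qed.

Hypothesis simplicial : forall v, v \in W -> cliq (N v) -> (0 < nF v)%N.

(** From degree [D0] on, the shortfall of a clique neighborhood is at most 1/2, which one half-edge
    outside [F] pays, and a non-clique neighborhood has no shortfall. *)
Lemma slack_ge0 v : v \in W -> 0 <= slack v.
Proof.
move=> vW; have [ltD|leD] := ltnP #|N v| D0.
  by apply: le_trans (slack_low vW ltD); apply: ler0n.
have {}leD' : D0%:R <= #|N v|%:R :> rat by rewrite ler_nat.
have n0 : 0 < #|N v|%:R :> rat.
  by rewrite ltr0n; apply: leq_trans leD; apply: leq_ltn_trans dD0.
have s0 : 0 <= (nF v)%:R :> rat by apply: ler0n.
rewrite slackE //; case: ifP => [cN|_].
  have : 1 <= (nF v)%:R :> rat by rewrite ler1n simplicial.
  have : D0%:R / (#|N v|%:R + 1) <= 1 :> rat by rewrite ler_pdivrMr; lra.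
  by lra.
have : D0%:R / #|N v|%:R <= 1 :> rat by rewrite ler_pdivrMr; lra.
by lra.
Qed.

(** Put n = [#|N v|] and x = [D0 / (n + 1)]. Each of the n neighbors has slack at least (1 - x) / 2
    and [v] has [(nF v - x) / 2]. Since (n + 1) x = [D0], the sum is at least [(nF v + n - D0) / 2],
    hence at least [r] by the degree of [v]. *)
Lemma slack_clique_sum v : v \in W -> (forall w, w \in v |: N v -> (D0 <= #|N w|)%N) ->
  cliq (N v) -> r%:R <= \sum_(w in v |: N v) slack w.
Proof.
move=> vW leD cN; have vN : v \notin N v by apply: (notin_neighbors flatF).
set n := #|N v|; have n_leD : (D0 <= n)%N by apply: leD; apply: setU11.
have NW : N v \subset W by apply/subsetP => x; rewrite inE => /andP[].
have n_gt0 : (0 < n)%N by apply: leq_trans n_leD; apply: leq_ltn_trans dD0.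
have cC : cliq (v |: N v).
  rewrite /cliq clique_edgesU1 // subUset; apply/andP; split=> //.
  by apply/subsetP => _ /imsetP [x xN ->]; move: xN; rewrite inE => /andP[].
have q_gt0 : 0 < n%:R + 1 :> rat by rewrite natr1 ltr0n.
have each w : w \in N v -> (1 - D0%:R / (n%:R + 1)) / 2 <= slack w.
  move=> wN; have wW := subsetP NW w wN.
  have sub : (v |: N v) :\ w \subset N w.
    apply/subsetP => x /setD1P [xw xC]; rewrite inE; apply/andP; split.
      by case/setU1P: xC => [->//|/(subsetP NW)].
    by apply: (subsetP cC); rewrite mem_clique_edges eq_sym xw xC setU1r.
  have cC1 : #|(v |: N v) :\ w| = n.
    by have := cardsD1 w (v |: N v); rewrite setU1r // cardsU1 vN => -[].
  have n_le : (n <= #|N w|)%N by rewrite -cC1 subset_leq_card.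
  rewrite slackE; last by apply/leD/setU1r.
  have D0_ge0 : 0 <= D0%:R :> rat by apply: ler0n.
  case: ifP => [cw|ncw].
    have : 1 <= (nF w)%:R :> rat by rewrite ler1n simplicial.
    have : D0%:R / (#|N w|%:R + 1) <= D0%:R / (n%:R + 1) :> rat.
      by rewrite ler_wpM2l // lef_pV2 ?posrE ?natr1 ?ltr0n // ler_nat.
    by lra.
  (* [N w] contains the clique without [w], which has n vertices; equality would make [N w] a
     clique. *)
  have ltn : (n < #|N w|)%N.
    rewrite ltn_neqAle n_le andbT; apply: contraFneq ncw => nE.
    have /eqP <- : (v |: N v) :\ w == N w by rewrite eqEcard sub cC1 nE leqnn.
    by apply: subset_trans cC; apply: clique_edgesS; apply: subD1set.
  have : 0 <= (nF w)%:R :> rat by apply: ler0n.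
  have : D0%:R / #|N w|%:R <= D0%:R / (n%:R + 1) :> rat.
    rewrite ler_wpM2l // lef_pV2 ?posrE ?natr1 ?ltr0n ?ler_nat //.
    exact: leq_ltn_trans ltn.
  by lra.
rewrite big_setU1 //= slackE // cN -/n.
have : n%:R * ((1 - D0%:R / (n%:R + 1)) / 2) <= \sum_(w in N v) slack w.
  by rewrite mulr_natl -sumr_const; apply: ler_sum.
have := degree_bound vW; rewrite -/n -(ler_nat rat) 2!natrD (natrM _ 2 r).
set D : rat := D0%:R; set s : rat := (nF v)%:R => deg.
set x : rat := D / (n%:R + 1).
have : x * (n%:R + 1) = D by rewrite /x mulfVK // gt_eqF.
by lra.
Qed.

(** A vertex of degree below [D0], or a simplicial vertex with its neighborhood, already supplies
    [r]. If [K] had neither, every vertex would have weight at least [d], and [order_bound] would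
    give the clique on [K] rank at least [d * #|K|], more than [rk_clique] allows. *)
Lemma slack_sum (K : {set V}) : K != set0 -> K \subset W ->
  (forall v, v \in K -> N v \subset K) -> r%:R <= \sum_(v in K) slack v.
Proof.
move=> K0 KW clK.
have sub_sum (C : {set V}) : C \subset K -> \sum_(v in C) slack v <= \sum_(v in K) slack v.
  move=> CK; rewrite [leRHS](big_setID C) /= (setIidPr CK) lerDl sumr_ge0 // => v.
  by case/setDP => vK _; apply/slack_ge0/(subsetP KW).
have [/existsP [v /andP[vK ltD]]|allD] := boolP [exists v in K, (#|N v| < D0)%N].
  apply: le_trans (sub_sum [set v] _); last by rewrite sub1set.
  by rewrite big_set1 slack_low // (subsetP KW).
have {}allD w : w \in K -> (D0 <= #|N w|)%N.
  by move=> wK; have := exists_inPn allD w wK; rewrite -leqNgt.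
have [/existsP [v /andP[vK cv]]|allN] := boolP [exists v in K, cliq (N v)].
  have vNK : v |: N v \subset K by rewrite subUset sub1set vK clK.
  apply: le_trans (sub_sum _ vNK); apply: slack_clique_sum => //.
    exact: subsetP KW v vK.
  by move=> w /(subsetP vNK); apply: allD.
have K_gt0 : (0 < #|K|)%N by rewrite card_gt0.
have : \sum_(v in K) order_weight d F (neighbors F K v) <= (rho (clique_edges K))%:R.
  apply: le_trans (order_bound rhoP d_gt0 flatF K) _; rewrite ler_nat.
  apply: (rk_mono rhoP); apply/subsetP => e; rewrite !inE => /andP[eF ->].
  by have [/subsetP sF _] := flatF; have := sF e eF; rewrite inE => ->.
have lt_d : (rho (clique_edges K) < #|K| * d)%N.
  by rewrite (rk_clique rhoP) sum_minn_lt.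
move=> le_rho; suff : (#|K| * d)%:R <= (rho (clique_edges K))%:R :> rat.
  by rewrite ler_nat leqNgt lt_d.
apply: le_trans le_rho; rewrite natrM mulr_natl -sumr_const; apply: ler_sum => v vK.
have -> : neighbors F K v = N v.
  apply/setP => x; rewrite !inE.
  have [vxF|] := boolP ([set v; x] \in F); last by rewrite !andbF.
  rewrite !andbT; apply/idP/idP => [/(subsetP KW) //|xW].
  by apply: (subsetP (clK v vK)); rewrite inE xW.
have leD := allD v vK; have dN : (d < #|N v|)%N by apply: leq_trans leD.
rewrite (order_weightE d_gt0 _ (ltnW dN)).
have := exists_inPn allN v vK; rewrite /cliq => /negPf ->.
have n_gt0 : 0 < #|N v|%:R :> rat by rewrite ltr0n (leq_ltn_trans _ dN).
rewrite /nonclique_bound -D0E -addrA lerDl subr_ge0 ler_pdivrMr ?mulr_gt0 //.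
have : D0%:R <= #|N v|%:R :> rat by rewrite ler_nat.
by lra.
Qed.

(** [Rt] holds one representative of each component of [induced F W]. Each component has slack at
    least [r], and the total slack is bounded above by [order_bound] and [handshake]. *)
Lemma slack_total (Rt : {set V}) :
  (forall v, v \in W -> fingraph.root (adj (induced F W)) v \in Rt) ->
  (forall v, v \in Rt -> v \in W /\ fingraph.root (adj (induced F W)) v = v) ->
  (d * #|W| + r * #|Rt| <= #|E :\: F| + rho (induced F W))%N.
Proof.
move=> WRt RtW; pose f := adj (induced F W).
have fsym : connect_sym f by apply: connect_adj_sym.
have : \sum_(x in Rt) r%:R <= \sum_(v in W) slack v.
  rewrite [leRHS](partition_big (fingraph.root f) (mem Rt)) //=; apply: ler_sum => x xRt.
  have [xW rx] := RtW x xRt.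
  pose K := [set v in W | fingraph.root f v == x].
  rewrite (eq_bigl (fun v => v \in K)); last by move=> v; rewrite inE.
  apply: slack_sum.
  - by apply/set0Pn; exists x; rewrite inE xW rx eqxx.
  - by apply/subsetP => v; rewrite inE => /andP[].
  move=> v; rewrite inE => /andP[vW /eqP rv]; apply/subsetP => w.
  rewrite !inE => /andP[wW vwF]; rewrite wW -rv eq_sym /=.
  rewrite root_connect // connect1 // /f /adj !inE vwF.
  by rewrite subUset !sub1set vW wW.
rewrite sumr_const /slack !big_split /= sumrN !sumr_const -mulr_suml => le_slack.
have le_order := order_bound rhoP d_gt0 flatF W.
have := handshake; rewrite -(ler_nat rat) natr_sum natrM => le_hand.
rewrite -(ler_nat rat) !natrD !natrM.
move: le_slack; rewrite -[r%:R *+ _]mulr_natr -[d%:R *+ _]mulr_natr.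
move: le_order le_hand; rewrite /N /nF; lra.
Qed.

End Slack.
End Main.

(** * Deletion of simplicial vertices *)

Section MainInduction.
Variables (V : finType) (d r : nat) (rho : {set {set V}} -> nat).
Hypothesis rhoP : rigidity_axioms d rho.
Hypothesis d_gt0 : (0 < d)%N.
Variable F : {set {set V}}.
Hypothesis flatF : flat rho F.

(* Vertices that are simplicial in F and meet no edge of E outside F are deleted;
   once there are none, each component of F has total slack at least r. *)
Theorem flat_bound (W : {set V}) (E : {set {set V}}) :
  connected_on (d * (d + 1) + 2 * r) W E -> induced F W \subset E ->
  clique_edges W \subset F \/
  exists Rt : {set V}, [/\ Rt != set0, Rt \subset W,
    forall v, v \in W -> exists2 x, x \in Rt & connect (adj (induced F W)) x v
    & (d * #|W| + r * #|Rt| <= #|E :\: F| + rho (induced F W))%N].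
Proof.
have [m] := ubnP #|W|; elim: m W E => // m IHm W E cW connW sFE.
have [mW sEW _] := connW.
have [/existsP [v /and3P[vW cN /eqP nF0]]|nosimp] :=
  boolP [exists v, [&& v \in W, clique_edges (neighbors F W v) \subset F
                     & #|neighbors (E :\: F) W v| == 0%N]]; last first.
  right; pose Rt := [set v in W | fingraph.root (adj (induced F W)) v == v].
  have fsym : connect_sym (adj (induced F W)) by apply: connect_adj_sym.
  have rootRt v : v \in W -> fingraph.root (adj (induced F W)) v \in Rt.
    move=> vW; rewrite inE (root_root fsym) eqxx andbT.
    by rewrite -(connect_adj_induced (connect_root _ v)).
  exists Rt; split.
  - have [v vW] : exists v, v \in W by apply/set0Pn; rewrite -card_gt0; apply: leq_ltn_trans mW.
    by apply/set0Pn; exists (fingraph.root (adj (induced F W)) v); apply: rootRt.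
  - by apply/subsetP => v; rewrite inE => /andP[].
  - move=> v vW; exists (fingraph.root (adj (induced F W)) v); first exact: rootRt.
    by rewrite fsym connect_root.
  apply: (slack_total rhoP d_gt0 flatF connW sFE) => // [v vW cN|v].
    rewrite lt0n; apply: contra nosimp => nF0; apply/existsP; exists v.
    by rewrite vW cN.
  by rewrite inE => /andP[vW /eqP].
pose N := neighbors F W v.
have NE : neighbors E W v \subset N.
  apply/subsetP => x; rewrite !inE => /andP[xW vxE]; rewrite xW /=.
  apply/negPn/negP => vxF; move/eqP: nF0; rewrite cards_eq0 => /eqP/setP/(_ x).
  by rewrite !inE xW vxF vxE.
have mN : (d * (d + 1) + 2 * r <= #|N|)%N.
  exact: leq_trans (connected_on_degree connW vW) (subset_leq_card NE).
have vN : v \notin N by apply: (notin_neighbors flatF).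
have NWv : N \subset W :\ v.
  apply/subsetP => x xN; rewrite !inE; move: (xN); rewrite inE => /andP[-> _].
  by rewrite andbT; apply: contraNneq vN => <-.
have cWv : #|W| = (#|W :\ v|).+1 by rewrite (cardsD1 v W) vW.
have dN : (d < #|N|)%N by apply: leq_trans mN; nia.
have vNF x : x \in N -> [set v; x] \in F by rewrite inE => /andP[].
have WE : W = v |: (W :\ v) by rewrite setD1K.
(* If [W] is too small for a deletion to preserve the connectivity, the degree bound forces [N] to
   be all of [W :\ v], and [W] is a clique of [F]. *)
have [small|big] := leqP #|W| (d * (d + 1) + 2 * r).+1.
  left; have NWE : N = W :\ v.
    by apply/eqP; rewrite eqEcard NWv -ltnS -cWv (leq_trans small).
  rewrite WE clique_edgesU1 ?inE ?eqxx // -NWE subUset cN.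
  by apply/subsetP => _ /imsetP [x xN ->]; apply: vNF.
have sFE' : induced F (W :\ v) \subset induced E (W :\ v).
  apply/subsetP => e; rewrite !inE => /andP[eF eW]; rewrite eW andbT.
  apply: (subsetP sFE); rewrite inE eF; apply: subset_trans eW _; exact: subD1set.
have connW' : connected_on (d * (d + 1) + 2 * r) (W :\ v) (induced E (W :\ v)).
  apply: connected_on_delete => //; apply: subset_trans sFE.
  apply: subset_trans (clique_edgesS NE) _.
  apply/subsetP => e eN; rewrite inE (subsetP cN) //=.
  move: eN; rewrite inE => /andP[_ /subset_trans]; apply.
  by apply: subset_trans NWv _; apply: subD1set.
have cW' : (#|W :\ v| < m)%N by rewrite -ltnS -cWv.
have [cl|[Rt [Rt0 RtW RtC le_Rt]]] := IHm _ _ cW' connW' sFE'.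
  by left; rewrite WE; apply: (flat_clique rhoP flatF cl NWv (ltnW dN)).
right; exists Rt; split=> //.
- by apply: subset_trans RtW _; apply: subD1set.
- have sub x y : connect (adj (induced F (W :\ v))) x y -> connect (adj (induced F W)) x y.
    apply: connect_adjS; apply/subsetP => e; rewrite !inE => /andP[-> /subset_trans]; apply.
    exact: subD1set.
  move=> w wW; have [->|wv] := eqVneq w v; last first.
    have [|x xRt xw] := RtC w; first by rewrite !inE wv.
    by exists x => //; apply: sub.
  have [x xN] : exists x, x \in N by apply/set0Pn; rewrite -card_gt0; apply: leq_ltn_trans dN.
  have [y yRt yx] := RtC x (subsetP NWv x xN).
  exists y => //; apply: connect_trans (sub _ _ yx) (connect1 _).
  rewrite /adj setUC inE vNF //= subUset !sub1set vW.
  by move: xN; rewrite inE => /andP[].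
(* The last weight of a clique with more than [d] vertices is [d]; it pays for the increase of
   [d * #|W|] caused by putting [v] back. *)
have := rank_last rhoP d_gt0 flatF vW.
rewrite /last_weight -/N [(#|N| <= d)%N]leqNgt dN cN /= => le_rho.
have : (#|induced E (W :\ v) :\: F| <= #|E :\: F|)%N.
  by apply/subset_leq_card/setSD/subsetP => e; rewrite inE => /andP[].
move=> leE; rewrite cWv mulnS -addnA; apply: leq_trans (leq_add (leqnn d) le_Rt) _.
by rewrite addnCA; apply: leq_add leE _; rewrite addnC.
Qed.

End MainInduction.

Local Open Scope nat_scope.

(** * Matroid union *)

Lemma sum_option (I : finType) (f : option I -> nat) :
  \sum_c f c = f None + \sum_i f (Some i).
Proof.
rewrite (bigD1 None) //=; congr (_ + _).
rewrite (reindex_omap Some id) /= => [|[c|]//].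
by apply: eq_bigl => c; rewrite eqxx.
Qed.

Section MatroidUnion.
Variable T : finType.

Definition rank_function (rk : {set T} -> nat) : Prop :=
  [/\ rk set0 = 0, forall F G : {set T}, F \subset G -> rk F <= rk G
    & forall F G : {set T}, rk (F :|: G) + rk (F :&: G) <= rk F + rk G].

Lemma rank_function_uniform k : rank_function (fun X => minn #|X| k).
Proof.
split=> [|F G /subset_leq_card|F G]; first by rewrite cards0 min0n.
  by rewrite !leq_min geq_minr andbT => FG; apply: leq_trans (geq_minl _ _) FG.
have := subset_leq_card (subsetIl F G); have := subset_leq_card (subsetIr F G).
by have := cardsUI F G; lia.
Qed.

(* Rado's argument: while some list L e has two colors, one of them may be
   dropped without violating the counting condition. *)
Lemma colored_partition (C : finType) (c0 : C) (rk : C -> {set T} -> nat)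
    (E : {set T}) (L : T -> {set C}) :
  (forall c, rank_function (rk c)) ->
  (forall Y : {set T}, Y \subset E -> #|Y| <= \sum_c rk c [set e in Y | c \in L e]) ->
  exists col : T -> C,
    forall c, #|[set e in E | col e == c]| <= rk c [set e in E | col e == c].
Proof.
move=> rkP; pose Lc (L : T -> {set C}) (Y : {set T}) c := [set e in Y | c \in L e].
have [m] := ubnP (\sum_(e in E) #|L e|); elim: m L => // m IHm L cL HL.
pose cond (L : T -> {set C}) :=
  [forall Y : {set T}, (Y \subset E) ==> (#|Y| <= \sum_c rk c (Lc L Y c))].
have [/existsP [e /andP[eE two]]|none] := boolP [exists e in E, 1 < #|L e|].
  have [x [y [xL yL xy]]] : exists x y, [/\ x \in L e, y \in L e & x != y].
    by case/card_gt1P: two => x [y [xL yL xy]]; exists x, y.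
  pose drop z f := if f == e then L e :\ z else L f.
  have drop_ne z f : f != e -> drop z f = L f by rewrite /drop => /negPf ->.
  have drop_e z : drop z e = L e :\ z by rewrite /drop eqxx.
  have reduce z : z \in L e -> cond (drop z) -> exists col : T -> C,
    forall c, #|[set e in E | col e == c]| <= rk c [set e in E | col e == c].
    move=> zL /forallP H; apply: IHm (drop z) _ _ => [|Y YE]; last by have /implyP := H Y; apply.
    rewrite -ltnS; apply: leq_trans cL; rewrite ltnS (bigD1 e) //= [ltnRHS](bigD1 e) //=.
    rewrite drop_e [ltnRHS](_ : _ = (#|L e :\ z| + \sum_(i in E | i != e) #|drop z i|).+1) //.
    rewrite (cardsD1 z (L e)) zL add1n addSn; congr (_ + _).+1.
    by apply: eq_bigr => f /andP[_ /drop_ne ->].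
  have [/(reduce x xL) //|nx] := boolP (cond (drop x)).
  have [/(reduce y yL) //|ny] := boolP (cond (drop y)).
  have violate z : ~~ cond (drop z) -> exists Y : {set T},
      [/\ Y \subset E, e \in Y & \sum_c rk c (Lc (drop z) Y c) < #|Y|].
    rewrite negb_forall => /existsP [Y]; rewrite negb_imply -ltnNge => /andP[YE lt].
    exists Y; split=> //; apply: contraLR lt => eY; rewrite -leqNgt.
    apply: leq_trans (HL Y YE) _; apply: leq_sum => c _.
    have [_ mono _] := rkP c; apply: mono; apply/subsetP => f; rewrite !inE => /andP[fY cf].
    by rewrite fY drop_ne //; apply: contraNneq eY => <-.
  have [Y [YE eY ltY]] := violate x nx; have [Z [ZE eZ ltZ]] := violate y ny.
  (* Uncrossing: as [x != y], the union of the two shortened lists of [e] is its full list, so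
     [Y :|: Z] satisfies the original condition; so does [Y :&: Z] without [e]. By submodularity the
     ranks would sum to at least [#|Y| + #|Z| - 1], but the two violations leave at most
     [#|Y| + #|Z| - 2]. *)
  pose U c := Lc (drop x) Y c; pose W c := Lc (drop y) Z c.
  have leUW : \sum_c rk c (U c :|: W c) + \sum_c rk c (U c :&: W c) <=
      \sum_c rk c (U c) + \sum_c rk c (W c).
    by rewrite -!big_split; apply: leq_sum => c _; have [_ _] := rkP c; apply.
  have leU : #|Y :|: Z| <= \sum_c rk c (U c :|: W c).
    have /HL H : Y :|: Z \subset E by rewrite subUset YE.
    apply: leq_trans H _; apply: leq_sum => c _; have [_ mono _] := rkP c; apply: mono.
    apply/subsetP => f; rewrite !inE; have [->|fe] := eqVneq f e; last first.
      by rewrite !drop_ne //; case: (_ \in Y); case: (_ \in Z); case: (_ \in L f).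
    rewrite eY eZ !drop_e !inE /= => ->; rewrite !andbT.
    by case: eqP => //= ->.
  have leI : #|(Y :&: Z) :\ e| <= \sum_c rk c (U c :&: W c).
    have /HL H : (Y :&: Z) :\ e \subset E.
      by apply: subset_trans (subD1set _ _) _; apply: subset_trans (subsetIl _ _) YE.
    apply: leq_trans H _; apply: leq_sum => c _; have [_ mono _] := rkP c; apply: mono.
    apply/subsetP => f; rewrite !inE => /andP[/and3P[fe -> ->] cf].
    by rewrite !drop_ne // cf.
  have := cardsUI Y Z; rewrite (cardsD1 e (Y :&: Z)) inE eY eZ /=.
  move: leUW leU leI ltY ltZ; rewrite -/(U _) -/(W _).
  move: (\sum_c rk c (U c :|: W c)) (\sum_c rk c (U c :&: W c)) => a b.
  rewrite -[\sum_c rk c (Lc (drop x) Y c)]/(\sum_c rk c (U c)).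
  rewrite -[\sum_c rk c (Lc (drop y) Z c)]/(\sum_c rk c (W c)).
  move: (\sum_c rk c (U c)) (\sum_c rk c (W c)) => a' b'.
  by lia.
have L0 e : e \in E -> exists c, L e = [set c].
  move=> eE; apply/cards1P; rewrite eqn_leq; apply/andP; split.
    by have := exists_inPn none e eE; rewrite -leqNgt.
  rewrite card_gt0; apply/eqP => Le; have := HL [set e].
  rewrite sub1set eE cards1 big1 => [/(_ isT)//|c _].
  have [rk0 _ _] := rkP c; rewrite -[RHS]rk0; congr rk; apply/setP => f.
  by rewrite !inE; case: eqP => //= ->; rewrite Le inE.
pose col e := odflt c0 [pick c in L e].
exists col => c.
have colE e : e \in E -> (col e == c) = (c \in L e).
  move=> /L0 [c' Le]; rewrite /col Le; case: pickP => [c''|/(_ c')]; rewrite inE.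
    by move/eqP=> ->; rewrite inE eq_sym.
  by rewrite eqxx.
set Y := [set e in E | col e == c].
have YE : Y \subset E by apply/subsetP => e; rewrite inE => /andP[].
have := HL Y YE; rewrite (bigD1 c) //= big1 => [|c' c'c].
  rewrite addn0 (_ : [set e in Y | c \in L e] = Y) //.
  by apply/setP => e; rewrite !inE; case eE: (e \in E) => //=; rewrite colE ?eE // andbb.
have [rk0 _ _] := rkP c'; rewrite -[RHS]rk0; congr rk; apply/setP => e.
rewrite !inE; case eE: (e \in E) => //=; rewrite colE ?eE //.
have [c1 ->] := L0 e eE; rewrite !inE.
by case: eqP => //= <-; rewrite (negPf c'c).
Qed.

Theorem matroid_packing (C : finType) (rk : C -> {set T} -> nat) (E : {set T}) (n : nat) :
  (forall c, rank_function (rk c)) ->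
  (forall F : {set T}, F \subset E -> n <= #|E :\: F| + \sum_c rk c F) ->
  exists B : C -> {set T},
    [/\ forall c, B c \subset E, forall c c', c != c' -> [disjoint B c & B c'],
      forall c, #|B c| <= rk c (B c) & n <= \sum_c #|B c|].
Proof.
move=> rkP Hn.
pose rk' (c : option C) := if c is Some c then rk c else fun X => minn #|X| (#|E| - n).
have rkP' c : rank_function (rk' c).
  by case: c => [c|]; [apply: rkP|apply: rank_function_uniform].
have cardY (Y : {set T}) : Y \subset E -> #|E :\: Y| + #|Y| = #|E|.
  by move=> YE; rewrite -(cardsID Y E) (setIidPr YE) addnC.
have nE : n <= #|E|.
  have := Hn set0 (sub0set _); rewrite setD0 big1 ?addn0 // => c _.
  by have [] := rkP c.
have [Y YE|col Hcol] := @colored_partition _ None rk' E (fun=> setT) rkP'.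
  have -> : \sum_c rk' c [set e in Y | c \in [set: option C]] = \sum_c rk' c Y.
    by apply: eq_bigr => c _; congr rk'; apply/setP => e; rewrite !inE andbT.
  by rewrite sum_option /=; have := Hn Y YE; have := cardY Y YE; lia.
exists (fun c => [set e in E | col e == Some c]); split.
- by move=> c; apply/subsetP => e; rewrite inE => /andP[].
- move=> c c' cc'; rewrite -setI_eq0; apply/eqP/setP => e; rewrite !inE.
  by case: (_ \in E) => //=; case: eqP => //= ->; apply: contraNF cc' => /eqP[->].
- by move=> c; apply: (Hcol (Some c)).
have := Hcol None; rewrite /= leq_min => /andP[_ leN].
have : #|E| = \sum_c #|[set e in E | col e == c]|.
  rewrite -sum1_card (partition_big col predT) //=; apply: eq_bigr => c _.
  by rewrite -sum1_card; apply: eq_bigl => e; rewrite inE.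
by rewrite sum_option; lia.
Qed.

End MatroidUnion.

(** * Packing a rigid graph and spanning trees *)

Lemma complete_graphE (V : finType) : complete_graph V = clique_edges [set: V].
Proof. by apply/setP => e; rewrite !inE subsetT andbT. Qed.

Lemma rank_function_rigidity (V : finType) d (rho : {set {set V}} -> nat) :
  rigidity_axioms d rho -> rank_function rho.
Proof.
move=> rhoP; split; [|exact: rk_mono rhoP|exact: rk_submod rhoP].
by apply/eqP; rewrite -leqn0 -(cards0 {set V}); apply: rk_card rhoP _.
Qed.

Lemma connect_cut (V : finType) d (rho : {set {set V}} -> nat) (F : {set {set V}}) x y :
  rigidity_axioms d rho -> F \subset complete_graph V ->
  rho ([set x; y] |: F) <= rho F -> connect (adj F) x y.
Proof.
move=> rhoP sF; apply: contraTT => nxy; rewrite -ltnNge.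
apply: (rk_cut rhoP (A := [set z | connect (adj F) x z])); rewrite ?inE ?connect0 //.
  by move=> e /(subsetP sF); rewrite inE => /eqP.
by move=> u w uw; rewrite !inE => xu; apply: connect_trans xu (connect1 _).
Qed.

(** This carries representatives of the components from the closure back to [F], whose graphic rank
    enters the union condition. *)
Lemma connect_rclosure (V : finType) d (rho : {set {set V}} -> nat) (F : {set {set V}}) x y :
  rigidity_axioms d rho -> F \subset complete_graph V ->
  connect (adj (rclosure rho F)) x y = connect (adj F) x y.
Proof.
move=> rhoP sF; apply/idP/idP; last exact/connect_adjS/sub_rclosure.
apply: connect_sub => u w; rewrite /adj inE => /andP[_].
exact: connect_cut rhoP sF.
Qed.

(** * The graphic matroid as the case of dimension 1 *)

Section Graphic.
Variables (V : finType) (g : {set {set V}} -> nat).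
Hypothesis gP : rigidity_axioms 1 g.

Lemma graphic_clique (A : {set V}) : g (clique_edges A) = #|A|.-1.
Proof.
rewrite (rk_clique gP); case: #|A| => [|n]; first by rewrite big_ord0.
elim: n => [|n IHn]; first by rewrite big_ord1 min0n.
by rewrite big_ord_recr /= IHn /=; lia.
Qed.

(** Induction on the path: for [d = 1], [rk_stress] says that two edges of a triangle span the
    third. *)
Lemma graphic_connect (F : {set {set V}}) x y : F \subset complete_graph V ->
  connect (adj F) x y -> x != y -> [set x; y] \in rclosure g F.
Proof.
move=> sF /connectP [p pF ->]; elim/last_ind: p pF => [|p z IHp] /=; first by rewrite eqxx.
rewrite rcons_path last_rcons => /andP[pF uz] xz.
have [xu|xu] := eqVneq x (last x p).
  by rewrite [in X in [set X; _]]xu; apply: (subsetP (sub_rclosure g sF)).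
have uzE : last x p != z.
  by have := subsetP sF _ uz; rewrite inE cards2; case: (_ != _).
have [_ flatF] := flat_rclosure gP sF.
apply: (flatF (rclosure g F)) => //; first by rewrite cards2 xz.
have xuC := IHp pF xu; have uzC := subsetP (sub_rclosure g sF) _ uz.
apply: (rk_stress gP (M := [set last x p])) => //.
- by rewrite cards1.
- by rewrite inE.
- by rewrite inE eq_sym.
move: (last x p) xuC uzC {pF IHp uz xu uzE} => w xwC wzC a b ab aS bS.
case/setUP: aS ab => [/set2P[->|->]|/set1P ->];
  case/setUP: bS => [/set2P[->|->]|/set1P ->] ab ne; rewrite ?eqxx // in ab ne *;
  first [by [] | by rewrite setUC | by rewrite setUC eqxx in ne].
Qed.

(** Adding the clique on [Rt] makes the graph connected, hence of rank [#|V|.-1], and costs at most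
    [#|Rt|.-1]. *)
Lemma graphic_span (F : {set {set V}}) (Rt : {set V}) :
  F \subset complete_graph V -> Rt != set0 ->
  (forall v, exists2 x, x \in Rt & connect (adj F) x v) -> #|V| <= g F + #|Rt|.
Proof.
move=> sF Rt0 RtC; pose G := F :|: clique_edges Rt.
have sG : G \subset complete_graph V.
  by rewrite subUset sF complete_graphE clique_edgesS // subsetT.
have connG x y : connect (adj G) x y.
  have sFG : F \subset G by apply: subsetUl.
  have [x' x'R x'x] := RtC x; have [y' y'R y'y] := RtC y.
  have xx' : connect (adj G) x x' by rewrite connect_adj_sym (connect_adjS sFG).
  apply: connect_trans xx' (connect_trans _ (connect_adjS sFG y'y)).
  have [->//|ne] := eqVneq x' y'; apply: connect1.
  by rewrite /adj inE mem_clique_edges ne x'R y'R orbT.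
have : g (complete_graph V) <= g (rclosure g G).
  apply: (rk_mono gP); rewrite complete_graphE.
  apply/subsetP => e /clique_edgesP [x [y [_ _ xy ->]]].
  exact: graphic_connect.
rewrite (rk_rclosure gP) // complete_graphE graphic_clique cardsT.
have := rkU gP F (clique_edges Rt); rewrite graphic_clique.
have : 0 < #|Rt| by rewrite card_gt0.
rewrite -/G; move: (g G) (g F) => a b; lia.
Qed.

Lemma graphic_spanning_tree (E T : {set {set V}}) : 0 < #|V| ->
  E \subset complete_graph V -> T \subset E ->
  #|V|.-1 <= g T -> #|T| <= g T -> spanning_tree E T.
Proof.
move=> V0 sE TE gT cT; have sT := subset_trans TE sE; split=> //.
  split; first by rewrite -card_gt0 cardsT.
  move=> x y _ _; have [->//|xy] := eqVneq x y.
  apply: (connect_cut gP sT); apply: leq_trans gT; rewrite -cardsT -graphic_clique.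
  apply: (rk_mono gP); rewrite -complete_graphE subUset sT sub1set inE cards2 xy //.
move=> [|x [|z q]] // uc cyc; rewrite leqNgt; apply/negP => qc.
have {qc} q_gt0 : 0 < size q by [].
have [xzq zq] : x \notin z :: q /\ z \notin q by case/and3P: uc.
move: cyc; rewrite /= rcons_path => /and3P[xz pzq yx].
pose y := last z q; have yq : y \in q.
  by rewrite /y; case: (q) q_gt0 => // w q' _; rewrite /= mem_last.
have xy : x != y by apply: contraNneq xzq => ->; rewrite inE yq orbT.
have zy : z != y by apply: contraNneq zq => ->.
(* The closing edge of the cycle is spanned by the remaining path, so the rank of [T] would be
   smaller than its size. *)
pose T' := T :\ [set x; y].
have sT' : T' \subset complete_graph V by apply: subset_trans (subD1set _ _) sT.
have xz' : adj T' x z.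
  rewrite /adj !inE (xz : _ \in T) andbT; apply: contraNneq zy => /setP/(_ z).
  by rewrite !inE eqxx orbT; case: eqP xzq => [->|_ _ /esym //]; rewrite inE eqxx.
have pzq' : path (adj T') z q.
  apply: (@sub_in_path _ (predC1 x) (adj T)) pzq => [u w ux wx uw|].
    rewrite /adj !inE (uw : _ \in T) andbT; apply: contraNneq ux => /setP/(_ x).
    by rewrite !inE eqxx /= eq_sym [x == w]eq_sym (negPf wx) orbF.
  by apply/allP => u uq; apply: contraNneq xzq => <-.
have cxy : connect (adj T') x y.
  by apply: connect_trans (connect1 xz') _; apply/connectP; exists q.
have := graphic_connect sT' cxy xy; rewrite inE => /andP[_].
have xyT : [set x; y] \in T by rewrite setUC.
rewrite setD1K // => le_g.
have : #|T| <= #|T'| by apply: leq_trans cT (leq_trans le_g (rk_card gP T')).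
by rewrite (cardsD1 [set x; y] T) xyT ltnn.
Qed.

End Graphic.

(** * The union condition and the packing *)

Section Packing.
Variables (V : finType) (d r : nat) (rho g : {set {set V}} -> nat).
Hypothesis rhoP : rigidity_axioms d rho.
Hypothesis gP : rigidity_axioms 1 g.
Hypothesis d_gt0 : 0 < d.

Theorem rigid_tree_packing (E : {set {set V}}) :
  simple_graph E -> k_connected (d * (d + 1) + 2 * r) E ->
  exists (H : {set {set V}}) (T : 'I_r -> {set {set V}}),
    [/\ H \subset E, rho H = rho (complete_graph V), disjoint_spanning_trees E T
      & forall i : 'I_r, [disjoint H & T i]].
Proof.
move=> simE [Vbig connE].
have sE : E \subset complete_graph V by apply/subsetP => e /simE e2; rewrite inE e2.
have V_gt0 : 0 < #|V| by apply: leq_trans Vbig.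
pose rk (c : option 'I_r) := if c is Some _ then g else rho.
have rkP c : rank_function (rk c).
  by case: c => [i|]; [apply: rank_function_rigidity gP|apply: rank_function_rigidity rhoP].
have rhoK : rho (complete_graph V) <= d * #|V|.
  by rewrite complete_graphE (rk_clique rhoP) cardsT mulnC ltnW // sum_minn_lt.
pose n := rho (complete_graph V) + r * #|V|.-1.
have cond (F : {set {set V}}) : F \subset E -> n <= #|E :\: F| + \sum_c rk c F.
  move=> FE; have sF := subset_trans FE sE.
  rewrite sum_option /= sum_nat_const card_ord.
  (* Passing to the closure keeps the rank and the components, and only shrinks the set of edges
     outside. *)
  set F' := rclosure rho F; have FF' : F \subset F' by apply: sub_rclosure.
  have flatF' : flat rho F' by apply: (flat_rclosure rhoP sF).
  have rhoF' : rho F' = rho F by apply: (rk_rclosure rhoP sF).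
  have induced_T : induced F' setT = F' by apply/setP => e; rewrite inE subsetT andbT.
  (* [flat_bound] wants the flat inside the graph; the edges added to [E] lie in [F'], so they are
     not counted outside it. *)
  have connW : connected_on (d * (d + 1) + 2 * r) [set: V] (E :|: F').
    split; first by rewrite cardsT.
      by rewrite -complete_graphE subUset sE; case: flatF'.
    move=> S cS u v; rewrite setTD => uS vS.
    have [_ /(_ u v uS vS)] := connE S cS; apply: connect_adjS.
    by apply/subsetP => e; rewrite !inE => /andP[-> ->].
  have [] := flat_bound rhoP d_gt0 flatF' connW; first by rewrite induced_T subsetUr.
    rewrite -complete_graphE => KF'.
    have rhoKF : rho (complete_graph V) <= rho F by rewrite -rhoF' (rk_mono rhoP).
    have [x0 _] : exists x0, x0 \in [set: V] by apply/set0Pn; rewrite -card_gt0 cardsT.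
    have := @graphic_span _ _ gP F [set x0] sF; rewrite cards1 => span.
    have gF : #|V|.-1 <= g F.
      rewrite -ltnS (prednK V_gt0) -addn1; apply: span => [|v].
        by apply/set0Pn; exists x0; rewrite inE.
      exists x0; first by rewrite inE.
      have [->|x0v] := eqVneq x0 v; first exact: connect0.
      rewrite -(connect_rclosure _ _ rhoP sF); apply/connect1/(subsetP KF').
      by rewrite inE cards2 x0v.
    by rewrite /n; apply: leq_trans (leq_addl _ _); apply: leq_add; rewrite ?leq_mul.
  case=> Rt [Rt0 _ RtC]; rewrite induced_T cardsT rhoF' in RtC *.
  have {RtC} RtC v : exists2 x, x \in Rt & connect (adj F) x v.
    have [x xR xv] := RtC v (in_setT v); exists x => //.
    by rewrite -(connect_rclosure _ _ rhoP sF).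
  have := graphic_span gP sF Rt0 RtC.
  have : #|(E :|: F') :\: F'| <= #|E :\: F|.
    apply/subset_leq_card/subsetP => e /setDP [/setUP [eE|eF']] neF'.
      by rewrite inE eE andbT; apply: contra neF' => /(subsetP FF').
    by rewrite eF' in neF'.
  (* With [rho (complete_graph V) <= d * #|V|] and [#|V| <= g F + #|Rt|], the surplus [r * #|Rt|] is
     what the [r] graphic ranks of [F] lack. *)
  rewrite /n.
  move: #|_ :\: F'| #|_ :\: F| (rho F) (g F) #|Rt| rhoK => a b c e t rhoK ab V_le main.
  have : r * #|V|.-1 <= r * (e + t) by rewrite leq_mul //; lia.
  by rewrite mulnDr; lia.
have [B [BE Bdis Brk le_n]] := matroid_packing rkP cond.
(* No class exceeds the rank of the complete graph in its matroid, and [n] is the sum of these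
   ranks, so every class attains its maximum. *)
have gK (T : {set {set V}}) : T \subset complete_graph V -> g T <= #|V|.-1.
  by rewrite -cardsT -(graphic_clique gP) -complete_graphE => sT; apply: (rk_mono gP).
have rhoB : rho (B None) <= rho (complete_graph V).
  by apply: (rk_mono rhoP); apply: subset_trans sE.
have gB i : #|B (Some i)| <= #|V|.-1.
  by apply: leq_trans (Brk (Some i)) (gK _ _); apply: subset_trans sE.
rewrite sum_option in le_n; have Bn := Brk None.
have sumB : \sum_(i < r) #|B (Some i)| <= r * #|V|.-1.
  by rewrite -[r in leqRHS]card_ord -sum_nat_const; apply: leq_sum.
exists (B None), (fun i => B (Some i)); split=> //.
- apply/eqP; rewrite eqn_leq rhoB /=; apply: leq_trans Bn.
  rewrite -(leq_add2r (r * #|V|.-1)); apply: leq_trans le_n _.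
  by rewrite leq_add2l.
- split=> [i|i j ij]; last by apply: Bdis; apply: contra ij => /eqP[->].
  apply: (graphic_spanning_tree gP) => //.
  apply: leq_trans (Brk (Some i)).
  have le_others : \sum_(j < r | j != i) #|B (Some j)| <= \sum_(j < r | j != i) #|V|.-1.
    exact: leq_sum.
  have : r * #|V|.-1 = #|V|.-1 + \sum_(j < r | j != i) #|V|.-1.
    rewrite -[r in LHS]card_ord -sum_nat_const.
    exact: (bigD1 i).
  move: le_n; rewrite /n (bigD1 i) //= => le_n rE; rewrite rE in le_n.
  have : rho (complete_graph V) + (#|V|.-1 + \sum_(j < r | j != i) #|V|.-1) <=
      rho (complete_graph V) + (#|B (Some i)| + \sum_(j < r | j != i) #|V|.-1).
    apply: leq_trans le_n _; apply: leq_add; first exact: leq_trans Bn rhoB.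
    by rewrite leq_add2l.
  by rewrite leq_add2l leq_add2r.
- by move=> i; apply: Bdis.
Qed.

End Packing.

(** * Rigid graphs are [d]-connected *)

Lemma sum_minn_submod (d s a b : nat) : s < d -> 0 < a -> 0 < b ->
  \sum_(j < a + s) minn j d + \sum_(j < b + s) minn j d <
  \sum_(j < a + b + s) minn j d + \sum_(j < s) minn j d.
Proof.
move=> sd; case: a => // a _ b0; elim: a => [|a IHa].
  rewrite add1n (_ : 1 + b + s = (b + s).+1); last by lia.
  rewrite 2!big_ord_recr /=.
  move: (\sum_(i < s) minn i d) (\sum_(i < b + s) minn i d) => x y; lia.
rewrite (_ : a.+2 + s = (a.+1 + s).+1) // (_ : a.+2 + b + s = (a.+1 + b + s).+1) //.
rewrite (big_ord_recr (a.+1 + s)) (big_ord_recr (a.+1 + b + s)) /=; move: IHa.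
move: (\sum_(i < s) minn i d) (\sum_(i < b + s) minn i d) => x y.
move: (\sum_(i < a.+1 + s) minn i d) (\sum_(i < a.+1 + b + s) minn i d) => z w.
by lia.
Qed.

Lemma sum_minn_formula (d k : nat) : d <= k ->
  2 * \sum_(j < k) minn j d + d * (d + 1) = 2 * (d * k).
Proof.
move=> dk; rewrite -(subnK dk); elim: (k - d) => [|n IHn].
  rewrite add0n; elim: d {dk} => [|d IHd]; first by rewrite big_ord0.
  rewrite big_ord_recr /= (eq_bigr (fun j : 'I_d => minn j d)); last first.
    by move=> j _; have := ltn_ord j; lia.
  move: IHd; move: (\sum_(i < d) minn i d) => x; nia.
rewrite addSn big_ord_recr /=; move: IHn; move: (\sum_(i < n + d) minn i d) => x; nia.
Qed.

(** If fewer than [d] vertices [S] separated [A] from [B], then [H] would lie in the union of the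
    cliques on [A :|: S] and [B :|: S], whose intersection contains the clique on [S]. By
    submodularity and [sum_minn_submod] its rank would be less than full. *)
Lemma rigid_k_connected (V : finType) (d : nat) (rho : {set {set V}} -> nat)
    (H : {set {set V}}) :
  rigidity_axioms d rho -> d < #|V| -> H \subset complete_graph V ->
  rho H = rho (complete_graph V) -> k_connected d H.
Proof.
move=> rhoP dV sH rigH; split=> // S Sd; have cS := cardsC S; split.
  by rewrite -card_gt0; lia.
move=> u v uS vS; apply/negPn/negP => nuv.
set f := adj (delete_vertices H S) in nuv.
pose A := [set z in ~: S | connect f u z]; pose B := ~: S :\: A.
have uS' : u \notin S by rewrite -in_setC.
have vS' : v \notin S by rewrite -in_setC.
have uA : u \in A by rewrite inE uS connect0.
have vB : v \in B by rewrite !inE vS' (negPf nuv).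
have AS : [disjoint A & S].
  by rewrite disjoints_subset; apply/subsetP => z; rewrite inE => /andP[].
have BS : [disjoint B & S].
  by rewrite disjoints_subset; apply/subsetP => z /setDP[].
have HAB : H \subset clique_edges (A :|: S) :|: clique_edges (B :|: S).
  apply/subsetP => e eH; have := subsetP sH e eH; rewrite inE => /cards2P [x [y [xy De]]].
  rewrite De in eH *; rewrite inE !mem_clique_edges xy /=.
  have cross a b : [set a; b] \in H -> a \in A -> b \notin S -> b \in A.
    move=> abH; rewrite !inE => /andP[aS ua] bS; rewrite bS.
    apply: connect_trans ua (connect1 _); rewrite /f /adj inE abH.
    by rewrite disjoints_subset subUset !sub1set !inE aS bS.
  rewrite !inE.
  have [xS|xS] := boolP (x \in S); have [yS|yS] := boolP (y \in S); rewrite ?orbT ?andbT //=.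
  - by rewrite !orbF; case: (connect f u y).
  - by rewrite !orbF; case: (connect f u x).
  have := cross x y eH; have := cross y x; rewrite setUC => /(_ eH).
  rewrite !inE xS yS /=.
  by case: (connect f u x) => [_ /(_ isT isT) ->|/(_ _ isT)] //;
    case: (connect f u y) => // /(_ isT).
have sAB : clique_edges S \subset clique_edges (A :|: S) :&: clique_edges (B :|: S).
  by rewrite subsetI !clique_edgesS ?subsetUr.
have cV : #|V| = #|A| + #|B| + #|S|.
  rewrite -cS addnC; congr (_ + _); rewrite -(cardsID A (~: S)); congr (_ + _).
  by apply: eq_card => z; rewrite !inE; case: (z \in S) => //=; rewrite andbb.
have := sum_minn_submod (s := #|S|) (a := #|A|) (b := #|B|) Sd.
have -> : 0 < #|A| by rewrite card_gt0; apply/set0Pn; exists u.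
have -> : 0 < #|B| by rewrite card_gt0; apply/set0Pn; exists v.
move=> /(_ isT isT); rewrite -cV -cardsT -!(rk_clique rhoP) -complete_graphE -rigH.
rewrite (_ : #|A| + #|S| = #|A :|: S|); last by rewrite cardsU disjoint_setI0 ?cards0 ?subn0.
rewrite (_ : #|B| + #|S| = #|B :|: S|); last by rewrite cardsU disjoint_setI0 ?cards0 ?subn0.
rewrite -!(rk_clique rhoP) ltnNge => /negP; apply.
apply: leq_trans (leq_add (rk_mono rhoP HAB) (rk_mono rhoP sAB)) _.
exact: rk_submod rhoP _ _.
Qed.

Lemma k_connectedS (V : finType) k (E E' : {set {set V}}) :
  E \subset E' -> k_connected k E -> k_connected k E'.
Proof.
move=> sE [kV kE]; split=> // S Sk; have [S0 conn] := kE S Sk; split=> // u v uS vS.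
apply: connect_adjS (conn u v uS vS); apply/subsetP => e; rewrite !inE => /andP[eE ->].
by rewrite (subsetP sE).
Qed.

(** * Sharpness *)

(* K_{m,m} with every vertex replaced by a clique of size m: the vertices
   (true, (i, j)) and (false, (i, j)) are the two ends of the edge ij of K_{m,m},
   lying in the cliques that replace i and j, respectively. *)
Section CliqueReplacement.
Variable m : nat.
Let V : finType := (bool * ('I_m * 'I_m))%type.
Implicit Types (x y : V).

Definition line x : bool * 'I_m := (x.1, if x.1 then x.2.1 else x.2.2).

Definition line_set (l : bool * 'I_m) : {set V} := [set x | line x == l].

Definition line_edges : {set {set V}} := \bigcup_l clique_edges (line_set l).

Definition rung_edges : {set {set V}} :=
  [set [set (true, p); (false, p)] | p : 'I_m * 'I_m].

Definition replaced_edges : {set {set V}} := line_edges :|: rung_edges.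

Lemma line_adj x y : line x = line y -> x != y -> adj replaced_edges x y.
Proof.
move=> lxy xy; rewrite /adj inE; apply/orP; left; apply/bigcupP; exists (line x) => //.
by rewrite mem_clique_edges xy !inE lxy eqxx.
Qed.

Lemma rung_adj s p : adj replaced_edges (s, p) (~~ s, p).
Proof.
rewrite /adj inE; apply/orP; right; apply/imsetP; exists p => //.
by case: s => //=; rewrite setUC.
Qed.

Lemma replaced_simple : simple_graph replaced_edges.
Proof.
move=> e /setUP [/bigcupP [l _]|/imsetP [p _ ->]]; last by rewrite cards2.
by rewrite !inE => /andP[/eqP].
Qed.

Lemma card_line_set l : #|line_set l| = m.
Proof.
case: l => s i; pose f (j : 'I_m) : V := (s, if s then (i, j) else (j, i)).
have -> : line_set (s, i) = [set f j | j : 'I_m].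
  apply/setP => [[t [a b]]]; rewrite inE; apply/eqP/imsetP => [|[j _ ->]].
    by case=> Es Ei; exists (if t then b else a) => //; rewrite /f -Es -Ei; case: (t).
  by rewrite /line /f /=; case: (s).
rewrite card_imset ?cardsT ?card_ord // => j j'.
by rewrite /f; case: s {f} => -[].
Qed.

Lemma card_rung_edges : #|rung_edges| <= m * m.
Proof. by apply: leq_trans (leq_imset_card _ _) _; rewrite card_prod card_ord. Qed.

(** Fewer than [m] deleted vertices miss some first index [i0] and some second index [j0]. Every
    rung with index [i0] or [j0] on the respective side survives, and along these rungs and the
    cliques each remaining vertex reaches the hub. *)
Lemma replaced_connected : 1 < m -> k_connected m replaced_edges.
Proof.
move=> m1; split; first by rewrite !card_prod card_bool card_ord; nia.
move=> S Sm.
have avoid (f : V -> 'I_m) : exists i, forall x, x \in S -> f x != i.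
  have : ~~ ([set: 'I_m] \subset f @: S).
    apply/negP => /subset_leq_card; rewrite cardsT card_ord leqNgt => /negP; apply.
    exact: leq_ltn_trans (leq_imset_card _ _) Sm.
  case/subsetPn => i _ iS; exists i => x xS; apply: contraNneq iS => <-.
  exact: imset_f.
have [i0 Hi] := avoid (fun x => x.2.1); have [j0 Hj] := avoid (fun x => x.2.2).
have freei s j : (s, (i0, j)) \notin S by apply/negP => /Hi; rewrite eqxx.
have freej s i : (s, (i, j0)) \notin S by apply/negP => /Hj; rewrite eqxx.
set f := adj (delete_vertices replaced_edges S).
have fE x y : x \notin S -> y \notin S -> adj replaced_edges x y -> connect f x y.
  move=> xS yS xy; apply: connect1; rewrite /f /adj inE (xy : _ \in _).
  by rewrite disjoints_subset subUset !sub1set !inE xS yS.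
have lineE x y : x \notin S -> y \notin S -> line x = line y -> connect f x y.
  by move=> xS yS lxy; have [->//|xy] := eqVneq x y; apply: fE => //; apply: line_adj.
pose hub : V := (false, (i0, j0)); have hubS : hub \notin S by apply: freei.
have rowi j : connect f (false, (i0, j)) hub.
  apply: connect_trans (_ : connect f _ (true, (i0, j))) _.
    by apply: fE => //; apply: (rung_adj false).
  apply: connect_trans (_ : connect f _ (true, (i0, j0))) _; first exact: lineE.
  by apply: fE => //; apply: (rung_adj true).
have toHub x : x \notin S -> connect f x hub.
  case: x => [[] [i j]] xS; last first.
    apply: connect_trans (_ : connect f _ (false, (i0, j))) (rowi j); exact: lineE.
  apply: connect_trans (_ : connect f _ (true, (i, j0))) _; first exact: lineE.
  apply: connect_trans (_ : connect f _ (false, (i, j0))) _.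
    by apply: fE => //; apply: (rung_adj true).
  exact: lineE.
split; first by apply/set0Pn; exists hub; rewrite inE.
move=> u v; rewrite !inE => uS vS; apply: connect_trans (toHub u uS) _.
by rewrite connect_adj_sym toHub.
Qed.

Section Counting.
Variables (d r : nat) (rho g : {set {set V}} -> nat).
Hypothesis rhoP : rigidity_axioms d rho.
Hypothesis gP : rigidity_axioms 1 g.
Hypothesis mE : m.+1 = d * (d + 1) + 2 * r.
Hypothesis d_gt1 : 1 < d.

Lemma rk_line_edges k (h : {set {set V}} -> nat) (X : {set {set V}}) :
  rigidity_axioms k h -> X \subset replaced_edges ->
  h X <= 2 * m * \sum_(j < m) minn j k + #|X :&: rung_edges|.
Proof.
move=> hP XE; have XU : X \subset line_edges :|: (X :&: rung_edges).
  apply/subsetP => e eX; have := subsetP XE e eX; rewrite inE => /orP[eL|eR].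
    by rewrite inE eL.
  by rewrite 2!inE eX eR orbT.
apply: leq_trans (rk_mono hP XU) _; apply: leq_trans (rkU hP _ _) _.
apply: leq_add; last exact: rk_card hP _.
have -> : 2 * m * \sum_(j < m) minn j k =
    \sum_(l : bool * 'I_m) h (clique_edges (line_set l)).
  rewrite [RHS](eq_bigr (fun=> \sum_(j < m) minn j k)) => [|l _]; last first.
    by rewrite (rk_clique hP) card_line_set.
  by rewrite sum_nat_const card_prod card_bool card_ord.
rewrite /line_edges; elim/big_rec2: _ => [|l a B _ IH].
  by rewrite -(cards0 {set V}); apply: rk_card hP _.
by apply: leq_trans (rkU hP _ _) _; rewrite leq_add2l.
Qed.

(** Comparing the rank on [2 m^2] vertices with that of [2 m] cliques of size [m], [H] needs at
    least [(2 m - 1) d (d + 1) / 2] rungs and each tree at least [2 m - 1]. Together these are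
    [(2 m - 1) (m + 1) / 2] rungs, more than the available [m^2]. *)
Lemma replaced_no_packing : ~ exists (H : {set {set V}}) (T : 'I_r -> {set {set V}}),
    [/\ H \subset replaced_edges, rho H = rho (complete_graph V),
      disjoint_spanning_trees replaced_edges T & forall i : 'I_r, [disjoint H & T i]].
Proof.
case=> H [T [HE rigH [treeT disT] disH]].
have dd : d * (d + 1) > 5 by nia.
have md : d <= m by nia.
have cV : #|V| = 2 * (m * m) by rewrite !card_prod card_bool card_ord.
have HR : (2 * m - 1) * (d * (d + 1)) <= 2 * #|H :&: rung_edges|.
  have := rk_line_edges rhoP HE; rewrite rigH complete_graphE (rk_clique rhoP) cardsT cV.
  have := sum_minn_formula md; have : d <= 2 * (m * m) by nia.
  move/sum_minn_formula.
  move: (\sum_(j < _) _) (\sum_(j < m) _) #|_| (d * (d + 1)) => a b c D Ea Eb le_a.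
  have : m * (2 * b + D) = m * (2 * (d * m)) by rewrite Eb.
  rewrite mulnBl mul1n; lia.
have TR i : 2 * m - 1 <= #|T i :&: rung_edges|.
  have [TE [_ conT] _] := treeT i.
  have := rk_line_edges gP TE.
  have : #|V| <= g (T i) + 1.
    have x0 : V by have i0 : 'I_m by [apply: (@Ordinal m 0); lia]; exact: (true, (i0, i0)).
    rewrite -(cards1 x0); apply: (graphic_span gP).
    - apply/subsetP => e /(subsetP TE) /replaced_simple e2; by rewrite inE e2.
    - by apply/set0Pn; exists x0; rewrite inE.
    by move=> v; exists x0; rewrite ?inE //; apply: conT; rewrite inE.
  have := @sum_minn_formula 1 m; have -> : 1 <= m by lia.
  move/(_ isT); rewrite cV.
  move: (\sum_(j < m) _) #|_| (g _) => a b c Ea le_c le_g.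
  have : m * (2 * a + 1 * (1 + 1)) = m * (2 * (1 * m)) by rewrite Ea.
  lia.
have le_sum : #|H :&: rung_edges| + \sum_(i < r) #|T i :&: rung_edges| <= m * m.
  apply: leq_trans card_rung_edges.
  pose U c := oapp T H c :&: rung_edges.
  have -> : #|H :&: rung_edges| + \sum_(i < r) #|T i :&: rung_edges| = \sum_c #|U c|.
    by rewrite sum_option.
  have disU c c' : c != c' -> [disjoint U c & U c'].
    move=> cc'; apply: disjointWl (subsetIl _ _) (disjointWr (subsetIl _ _) _).
    case: c c' cc' => [i|] [j|] // ij.
    - by apply: disT; apply: contra ij => /eqP ->.
    - by rewrite disjoint_sym; apply: disH.
    - exact: disH.
  rewrite (eq_bigr (fun c => \sum_(e in U c) 1)) => [|c _]; last by rewrite sum1_card.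
  rewrite -partition_disjoint_bigcup // sum1_card; apply/subset_leq_card/bigcupsP => c _.
  exact: subsetIr.
have : r * (2 * m - 1) <= \sum_(i < r) #|T i :&: rung_edges|.
  by rewrite -[r in leqLHS]card_ord -sum_nat_const; apply: leq_sum.
move: (\sum_(i < r) _) #|_| HR le_sum => a b HR le_ab le_a.
have : (2 * m - 1) * m.+1 <= 2 * (m * m).
  by rewrite mE mulnDr mulnCA [_ * r]mulnC; lia.
rewrite mulnBl mul1n; nia.
Qed.

End Counting.
End CliqueReplacement.

Local Open Scope ring_scope.

(** * Generic realizations *)

Lemma finite_roots (K : fieldType) (p : {poly K}) :
  p != 0 -> exists s : seq K, forall x, root p x -> x \in s.
Proof.
have [n] := ubnP (size p); elim: n p => // n IHn p sp p0.
have [[x rx]|nox] := boolp.EM (exists x, root p x); last first.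
  by exists [::] => x rx; case: nox; exists x.
have /factor_theorem [q Dp] := rx.
have q0 : q != 0 by apply: contraNneq p0 => q0; rewrite Dp q0 mul0r.
have [|s Ps] := IHn q _ q0.
  by move: sp; rewrite Dp size_Mmonic ?monicXsubC // size_XsubC; lia.
exists (x :: s) => y; rewrite Dp rootM root_XsubC in_cons.
by case/orP=> [/Ps ->|->] //; rewrite orbT.
Qed.

(** The roots of countably many nonzero polynomials form a countable set, hence not all of [R]: the
    unit interval has Lebesgue measure 1. *)
Lemma common_nonroot (R : realType) (T : countType) (f : T -> {poly R}) :
  exists x, forall t, f t != 0 -> ~~ root (f t) x.
Proof.
apply: boolp.contrapT => noroot.
pose D t : classical_sets.set R :=
  classical_sets.mkset (fun x => (f t != 0) && root (f t) x).
have Dcover : classical_sets.bigcup classical_sets.setT D = classical_sets.setT.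
  apply/classical_sets.seteqP; split=> // x _; apply: boolp.contrapT => nx; apply: noroot.
  exists x => t ft0; apply/negP => rx; apply: nx; exists t => //.
  by rewrite /D /= ft0.
have cD : cardinality.countable (classical_sets.bigcup classical_sets.setT D).
  apply: cardinality.bigcup_countable.
    exact: cardinality.countableP.
  move=> t _; apply: cardinality.finite_set_countable.
  have [ft0|ft0] := eqVneq (f t) 0.
    apply: (@cardinality.sub_finite_set _ _ classical_sets.set0) (cardinality.finite_set0 _).
    by move=> x.
  have [s Ps] := finite_roots ft0.
  apply: (@cardinality.sub_finite_set _ _ (classical_sets.mkset (fun x => x \in s))).
    by move=> x /= /Ps.
  exact: cardinality.finite_seq.
rewrite Dcover in cD.
have := @lebesgue_measure.countable_lebesgue_measure0 R
  (classical_sets.mkset (fun x => x \in `[0, 1]%R)).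
rewrite lebesgue_measure.lebesgue_measure_itv /= => H.
have: cardinality.countable (classical_sets.mkset (fun x : R => x \in `[0, 1]%R)).
  by apply: cardinality.sub_countable cD; apply: cardinality.subset_card_le.
move/H; rewrite constructive_ereal.lte_fin ltr01 -constructive_ereal.EFinB.
by move=> [] /eqP; rewrite subr0 oner_eq0.
Qed.

Lemma eval_ratr_sum (R : realType) (n : nat) (v : 'I_n -> R) (I : Type)
    (s : seq I) (Q : pred I) (a : I -> rat) (m : I -> 'X_{1..n}) :
  (map_mpoly (ratr : rat -> R) (\sum_(i <- s | Q i) a i *: 'X_[m i])).@[v] =
  \sum_(i <- s | Q i) ratr (a i) * \prod_(j < n) v j ^+ m i j.
Proof.
rewrite (_ : map_mpoly _ _ = \sum_(i <- s | Q i) ratr (a i) *: 'X_[m i]).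
  rewrite (big_morph (meval v) (mevalD _) (meval0 _)).
  by apply: eq_bigr => i _; rewrite mevalZ mevalX.
apply/mpolyP => k; rewrite mcoeff_map_mpoly !raddf_sum; apply: eq_bigr => i _.
by rewrite /= !mcoeffZ rmorphM !mcoeffX rmorph_nat.
Qed.

Lemma eval_ratrE (R : realType) (n : nat) (v : 'I_n -> R) (P : {mpoly rat[n]}) :
  (map_mpoly (ratr : rat -> R) P).@[v] =
  \sum_(m <- msupp P) ratr P@_m * \prod_(i < n) v i ^+ m i.
Proof.
rewrite mevalE (perm_big _ (msupp_map_mpoly P (fmorph_inj _))) /=.
by apply: eq_bigr => m _; rewrite mcoeff_map_mpoly.
Qed.

(** The new coordinate avoids the roots of all nonzero one-variable polynomials [f P] obtained by
    substituting [v] for the first [n] variables. A nonzero [P] gives a nonzero [f P], as its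
    coefficients are nonzero polynomials evaluated at the independent [v]. *)
Lemma algebraically_independent_exists (R : realType) (n : nat) :
  exists v : 'I_n -> R, forall P : {mpoly rat[n]},
    (map_mpoly (ratr : rat -> R) P).@[v] = 0 -> P = 0.
Proof.
elim: n => [|n [v Hv]].
  exists (fun=> 0) => P; rewrite (nvar0_mpolyC P) map_mpolyC ?mevalC //.
  by move/eqP; rewrite fmorph_eq0 => /eqP ->; rewrite mpolyC0.
pose w (i : 'I_n) : 'I_n.+1 := widen_ord (leqnSn n) i.
pose restr (m : 'X_{1..n.+1}) := [multinom m (w i) | i < n].
pose f (P : {mpoly rat[n.+1]}) : {poly R} := \sum_(m <- msupp P)
  (ratr P@_m * \prod_(i < n) v i ^+ m (w i)) *: 'X^(m ord_max).
(* [common_nonroot] asks for a countable index type: rational polynomials are coded by lists of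
   exponents with coefficients. *)
pose decode (s : seq (n.+1.-tuple nat * rat)) : {mpoly rat[n.+1]} :=
  \sum_(z <- s) z.2 *: 'X_[Multinom z.1].
have [x Hx] := common_nonroot (f \o decode).
have {}Hx P : f P != 0 -> ~~ root (f P) x.
  have <- : decode [seq (multinom_val m, P@_m) | m <- msupp P] = P.
    rewrite [RHS]mpolyE /decode big_map; apply: eq_bigr => m _ /=.
    by congr (_ *: 'X_[_]); apply: val_inj.
  exact: Hx.
pose v' (i : 'I_n.+1) := oapp v x (insub (val i)).
have v'w i : v' (w i) = v i by rewrite /v' /= valK.
have v'max : v' ord_max = x by rewrite /v' insubF //= ltnn.
exists v' => P evP0; apply/eqP; apply/contraT => P0.
have rfx : root (f P) x.
  apply/eqP; rewrite -[RHS]evP0 eval_ratrE /f horner_sum; apply: eq_bigr => m _.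
  rewrite hornerZ hornerXn big_ord_recr /= v'max mulrA; congr (_ * _ * _).
  by apply: eq_bigr => i _; rewrite v'w.
suff /Hx : f P != 0 by rewrite rfx.
have [m0 m0P] : exists m0, m0 \in msupp P.
  move: P0; rewrite -msupp_eq0; case: (msupp P) => // m s _.
  by exists m; rewrite mem_head.
pose k := m0 ord_max.
(* [c] is the coefficient of the [k]-th power of the last variable. On monomials with equal last
   exponent [restr] is injective, so the term of [m0] is not cancelled. *)
pose c : {mpoly rat[n]} := \sum_(m <- msupp P | m ord_max == k) P@_m *: 'X_[restr m].
have c_m0 : c@_(restr m0) = P@_m0.
  rewrite /c raddf_sum /= -big_filter (bigD1_seq m0) ?filter_uniq ?msupp_uniq //=;
    last by rewrite mem_filter eqxx.
  rewrite mcoeffZ mcoeffX eqxx mulr1 big1_seq ?addr0 // => m /andP[mm0].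
  rewrite mem_filter => /andP[/eqP mk _].
  rewrite mcoeffZ mcoeffX; case: eqP => [Er|]; rewrite ?mulr0 //.
  case/eqP: mm0; apply/mnmP => i.
  have [ltin|] := ltnP i n; last first.
    move=> nlei; suff -> : i = ord_max by rewrite mk.
    by apply: val_inj => /=; have := ltn_ord i; lia.
  have -> : i = w (Ordinal ltin) by apply: val_inj.
  by move/mnmP: Er => /(_ (Ordinal ltin)); rewrite !mnmE.
have : (f P)`_k = (map_mpoly (ratr : rat -> R) c).@[v].
  rewrite /f coef_sum eval_ratr_sum [RHS]big_mkcond; apply: eq_bigr => m _.
  rewrite coefZ coefXn eq_sym; case: eqP => _; rewrite ?mulr0 ?mulr1 //.
  congr (_ * _).
  by apply: eq_bigr => i _; rewrite mnmE.
move=> fk; apply: contraTneq m0P => f0; rewrite mcoeff_msupp negbK -c_m0.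
by rewrite (Hv c) ?mcoeff0 // -fk f0 coef0.
Qed.

Lemma generic_realizationP (R : realType) (V : finType) (d : nat) :
  generic (generic_realization R V d).
Proof.
apply: classical_sets.xgetPex.
have [v Hv] := algebraically_independent_exists R #|{: V * 'I_d}|.
exists [ffun x => \row_i v (enum_rank (x, i))] => P evP0; apply: Hv.
rewrite -evP0; apply: meval_eq => b.
by rewrite /coordinates ffunE mxE -surjective_pairing enum_valK.
Qed.

(** * The linear matroid of a family of row vectors *)

Section LinearRank.
Variables (K : fieldType) (T : finType) (n : nat) (phi : T -> 'rV[K]_n).
Implicit Types (F G : {set T}) (e : T).

Definition lspan F := (\sum_(e in F) <<phi e>>)%MS.
Definition lrank F := \rank (lspan F).

Lemma lspan_subP F m (A : 'M_(m, n)) :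
  reflect (forall e, e \in F -> (phi e <= A)%MS) (lspan F <= A)%MS.
Proof.
apply: (iffP sumsmx_subP) => H e /H; first by rewrite genmxE.
by rewrite genmxE.
Qed.

Lemma mem_lspan F e : e \in F -> (phi e <= lspan F)%MS.
Proof. by move: e; apply/lspan_subP. Qed.

Lemma lspanS F G : F \subset G -> (lspan F <= lspan G)%MS.
Proof. by move/subsetP=> sFG; apply/lspan_subP=> e /sFG /mem_lspan. Qed.

Lemma lspanU F G : (lspan (F :|: G) == lspan F + lspan G)%MS.
Proof.
apply/andP; split; last by rewrite addsmx_sub !lspanS ?subsetUl ?subsetUr.
apply/lspan_subP => e; rewrite inE => /orP[] eF.
  exact: submx_trans (mem_lspan eF) (addsmxSl _ _).
exact: submx_trans (mem_lspan eF) (addsmxSr _ _).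
Qed.

Lemma lrankS F G : F \subset G -> (lrank F <= lrank G)%N.
Proof. by move/lspanS/mxrankS. Qed.

Lemma lrank_submod F G :
  (lrank (F :|: G) + lrank (F :&: G) <= lrank F + lrank G)%N.
Proof.
rewrite /lrank (eqmx_rank (lspanU F G)) -[leqRHS]mxrank_sum_cap leq_add2l.
by rewrite mxrankS // sub_capmx !lspanS ?subsetIl ?subsetIr.
Qed.

Lemma lrankU F G : (lrank (F :|: G) <= lrank F + lrank G)%N.
Proof. exact: leq_trans (leq_addr _ _) (lrank_submod F G). Qed.

Lemma lrank_le F G : (forall e, e \in G -> (phi e <= lspan F)%MS) ->
  (lrank G <= lrank F)%N.
Proof. by move/lspan_subP/mxrankS. Qed.

Lemma lrank_card F : (lrank F <= #|F|)%N.
Proof.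
rewrite -sum1_card /lrank /lspan.
elim/big_rec2: _ => [|e k A _ Ak]; first by rewrite mxrank0.
rewrite (leq_trans (mxrank_adds_leqif _ _)) // leq_add // genmxE.
exact: rank_leq_row.
Qed.

Lemma lrankU1 F e :
  lrank (e |: F) = (~~ (phi e <= lspan F)%MS + lrank F)%N.
Proof.
have [sub|nsub] := boolP (phi e <= lspan F)%MS.
  apply/eqP; rewrite add0n eqn_leq; apply/andP; split; last first.
    by rewrite lrankS // subsetUr.
  by apply: lrank_le => f /setU1P [->|/mem_lspan].
apply/eqP; rewrite eqn_leq; apply/andP; split.
  by rewrite (leq_trans (lrankU _ _)) // leq_add2r (leq_trans (lrank_card _)) // cards1.
rewrite add1n; apply: rank_ltmx; rewrite ltmxE lspanS ?subsetUr //=.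
apply: contra nsub => sub; apply: submx_trans sub; exact: mem_lspan (setU11 _ _).
Qed.

(** For rigidity rows the column [c] is an assignment of velocities: an edge is spanned by [F] iff
    every infinitesimal motion of [F] preserves its length to first order. *)
Lemma lspan_dual F e :
  reflect (forall c : 'cV_n, (forall f, f \in F -> phi f *m c = 0) -> phi e *m c = 0)
          (phi e <= lspan F)%MS.
Proof.
apply: (iffP idP) => [sub c Fc|H].
  have sF : (lspan F <= kermx c)%MS by apply/lspan_subP => f /Fc fc; apply/sub_kermxP.
  by apply/sub_kermxP/(submx_trans sub).
rewrite submxE; apply/eqP/rowP => j; rewrite [RHS]mxE.
have Hj : phi e *m col j (cokermx (lspan F)) = 0.
  apply: H => f /mem_lspan; rewrite submxE => /eqP f0.
  by rewrite colE mulmxA f0 mul0mx.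
have /matrixP/(_ 0 0) := Hj; rewrite colE mulmxA -colE => Hj0.
by move: Hj0; rewrite [in LHS]mxE => ->; rewrite mxE.
Qed.

Lemma lspan_comb F u : (u <= lspan F)%MS ->
  exists a : T -> K, u = \sum_(e in F) a e *: phi e.
Proof.
case/sub_sumsmxP => w ->; have wP e : (w e *m <<phi e>> <= phi e)%MS.
  by rewrite (submx_trans (submxMl _ _)) // genmxE.
have H e : exists c, w e *m <<phi e>>%MS = c *: phi e.
  by have /sub_rVP := wP e.
have /boolp.choice [a aP] := H.
by exists a; apply: eq_bigr => e _.
Qed.

End LinearRank.

Lemma unit_minor (K : fieldType) (m n : nat) (A : 'M[K]_(m, n)) :
  exists (f : 'I_(\rank A) -> 'I_m) (g : 'I_(\rank A) -> 'I_n),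
    mxsub f g A \in unitmx.
Proof.
pose B := rowsub (maxrankfun A) A.
have fB : row_full B^T by rewrite /row_full mxrank_tr; apply: maxrowsub_free.
exists (maxrankfun A), (fullrankfun fB).
have -> : mxsub (maxrankfun A) (fullrankfun fB) A = (rowsub (fullrankfun fB) B^T)^T.
  by apply/matrixP => i j; rewrite !mxE.
rewrite unitmx_tr -row_free_unit.
exact: fullrowsub_free.
Qed.

Lemma rank_ge_minor (K : fieldType) (m n k : nat) (A : 'M[K]_(m, n))
    (f : 'I_k -> 'I_m) (g : 'I_k -> 'I_n) :
  mxsub f g A \in unitmx -> (k <= \rank A)%N.
Proof.
rewrite -row_free_unit => /eqP <-.
have -> : mxsub f g A = rowsub f 1%:M *m A *m colsub g 1%:M.
  rewrite -mulmxA mulmx_colsub mulmx1 mul_rowsub_mx mul1mx.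
  by apply/matrixP => i j; rewrite !mxE.
exact: leq_trans (mxrankM_maxl _ _) (mxrankM_maxr _ _).
Qed.

Definition eval_at (R : realType) (V : finType) (d : nat)
    (p : realization R V d) (P : {mpoly rat[#|{: V * 'I_d}|]}) : R :=
  (map_mpoly (ratr : rat -> R) P).@[coordinates p].

(* The minors of a polynomial matrix are polynomials, and one that is nonzero
   somewhere is nonzero at every generic point. *)
Lemma generic_rank_max (R : realType) (V : finType) (d : nat)
    (p q : realization R V d) (a b : nat)
    (Q : 'M[{mpoly rat[#|{: V * 'I_d}|]}]_(a, b)) :
  generic p ->
  (\rank (map_mx (eval_at q) Q) <= \rank (map_mx (eval_at p) Q))%N.
Proof.
move=> gp; have [f [g]] := unit_minor (map_mx (eval_at q) Q).
rewrite unitmxE unitfE => fg0; apply: (@rank_ge_minor _ _ _ _ _ f g).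
have evdet (s : realization R V d) k (M : 'M_k) :
    \det (map_mx (eval_at s) M) = eval_at s (\det M).
  rewrite (_ : map_mx (eval_at s) M =
    map_mx (meval (coordinates s)) (map_mx (map_mpoly ratr) M)).
    by rewrite det_map_mx det_map_mx.
  by apply/matrixP => i j; rewrite !mxE.
rewrite unitmxE unitfE -map_mxsub evdet; apply: contraNneq fg0 => /gp M0.
by rewrite -map_mxsub evdet M0 /eval_at rmorph0 meval0.
Qed.

(** * The generic rigidity matroid *)

Section EdgeRows.
Variables (R : realType) (V : finType) (d : nat).
Implicit Types (p : realization R V d) (E F : {set {set V}}) (u v w x y : V).

Definition edge_row p (e : {set V}) : 'rV[R]_#|{: V * 'I_d}| :=
  \row_b (if (enum_val b).1 \in e
          then \sum_(x in e) (p (enum_val b).1 0 (enum_val b).2 - p x 0 (enum_val b).2)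
          else 0).

Lemma rank_rigidity_matrix p E :
  \rank (rigidity_matrix E p) = lrank (edge_row p) E.
Proof.
have rowE a : row a (rigidity_matrix E p) = edge_row p (enum_val a).
  by apply/rowP => b; rewrite !mxE.
apply/eqP; rewrite eqn_leq; apply/andP; split; apply: mxrankS.
  by apply/row_subP => a; rewrite rowE mem_lspan ?enum_valP.
apply/lspan_subP => e eE; rewrite -(enum_rankK_in eE eE) -rowE.
exact: row_sub.
Qed.

Lemma edge_rowE p u v w (i : 'I_d) : u != v ->
  edge_row p [set u; v] 0 (enum_rank (w, i)) =
  (w == u)%:R * (p u 0 i - p v 0 i) + (w == v)%:R * (p v 0 i - p u 0 i).
Proof.
move=> uv; rewrite mxE enum_rankK /= big_setU1 ?big_set1 ?inE //=.
have [->|wu] := eqVneq w u; first by rewrite (negPf uv) subrr add0r mul1r mul0r addr0.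
have [->|wv] := eqVneq w v; first by rewrite subrr !mul1r mul0r addr0 add0r.
by rewrite !mul0r addr0.
Qed.

Lemma edge_row_mul p u v (c : 'cV_#|{: V * 'I_d}|) : u != v ->
  (edge_row p [set u; v] *m c) 0 0 =
  \sum_i (p u 0 i - p v 0 i) * (c (enum_rank (u, i)) 0 - c (enum_rank (v, i)) 0).
Proof.
move=> uv; rewrite mxE (reindex (@enum_rank {: V * 'I_d})) /=; last first.
  by apply: onW_bij; apply: enum_rank_bij.
transitivity (\sum_w \sum_i
    edge_row p [set u; v] 0 (enum_rank (w, i)) * c (enum_rank (w, i)) 0).
  by rewrite pair_bigA; apply: eq_bigr => [[w i]] _.
rewrite exchange_big; apply: eq_bigr => i _ /=.
rewrite (bigD1 u) //= (bigD1 v) 1?eq_sym //= !edge_rowE // !eqxx (negPf uv).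
rewrite eq_sym (negPf uv) big1 ?addr0; last first.
  by move=> w /andP[/negPf wu /negPf wv]; rewrite edge_rowE // wu wv !mul0r addr0 mul0r.
by rewrite !mul0r !mul1r addr0 add0r; ring.
Qed.

Lemma edge_row_mul0 p u v (c : 'cV_#|{: V * 'I_d}|) : u != v ->
  edge_row p [set u; v] *m c = 0 <->
  \sum_i (p u 0 i - p v 0 i) * (c (enum_rank (u, i)) 0 - c (enum_rank (v, i)) 0) = 0.
Proof.
move=> uv; rewrite -(edge_row_mul p c uv); split=> [->|H]; first by rewrite mxE.
by apply/matrixP => i j; rewrite !ord1 H mxE.
Qed.

Definition indep_diff p v (N : {set V}) : Prop :=
  forall a : V -> R, (forall i, \sum_(x in N) a x * (p v 0 i - p x 0 i) = 0) ->
  forall x, x \in N -> a x = 0.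

Definition aff_indep p (S : {set V}) : Prop :=
  forall a : V -> R, \sum_(x in S) a x = 0 ->
  (forall i, \sum_(x in S) a x * p x 0 i = 0) -> forall x, x \in S -> a x = 0.

Lemma aff_indep_diff p v (N : {set V}) :
  v \notin N -> aff_indep p (v |: N) -> indep_diff p v N.
Proof.
move=> vN H a Ha x xN; pose b y := if y == v then - \sum_(x in N) a x else a y.
have bN y : y \in N -> b y = a y.
  by rewrite /b; case: eqP => // -> vN'; rewrite vN' in vN.
have bv : b v = - \sum_(x in N) a x by rewrite /b eqxx.
rewrite -(bN _ xN); apply: H; rewrite ?inE ?xN ?orbT //.
  by rewrite big_setU1 //= (eq_bigr a) // bv addNr.
move=> i; rewrite big_setU1 //= bv.
rewrite [X in _ + X](eq_bigr (fun y => a y * p y 0 i)); last by move=> y yN; rewrite bN.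
have := Ha i; rewrite (eq_bigr (fun y => a y * p v 0 i - a y * p y 0 i)); last first.
  by move=> y _; rewrite mulrBr.
by rewrite sumrB -mulr_suml mulNr => H'; rewrite addrC -opprB H' oppr0.
Qed.

(** The rows of [F] vanish in the columns of [v]. A combination that yields the row of [vx], read in
    these columns, is a linear dependence among the directions from [v] to [N]. *)
Lemma lrank_star p v F (N : {set V}) :
  (forall e, e \in F -> v \notin e) -> v \notin N -> indep_diff p v N ->
  (lrank (edge_row p) F + #|N| <= lrank (edge_row p) (F :|: star v N))%N.
Proof.
move=> vF; have [n] := ubnP #|N|; elim: n N => // n IHn N Nn vN indN.
have [->|[x xN]] := set_0Vmem N.
  by rewrite cards0 addn0 lrankS ?subsetUl.
pose N' := N :\ x; have sN'N : N' \subset N by rewrite subD1set.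
have NE : N = x |: N' by rewrite setD1K.
have xN' : x \notin N' by rewrite !inE eqxx.
have starE : F :|: star v N = [set v; x] |: (F :|: star v N').
  by rewrite /star {1}NE imsetU1 setUCA.
have vx y : y \in N -> v != y by apply: contraTneq => <-.
have indN' : indep_diff p v N'.
  move=> a Ha y yN'; pose b z := if z \in N' then a z else 0.
  have by_ : b y = a y by rewrite /b yN'.
  rewrite -by_; apply: indN; last by apply: (subsetP sN'N).
  have bx : b x = 0 by rewrite /b (negPf xN').
  move=> i; rewrite NE big_setU1 //= bx mul0r add0r; apply: etrans (Ha i).
  by apply: eq_bigr => z zN'; rewrite /b zN'.
have vN' : v \notin N' by apply: contra vN => /(subsetP sN'N).
have cN : #|N| = #|N'|.+1 by rewrite [in LHS]NE cardsU1 xN'.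
rewrite starE lrankU1 cN addnS.
suff -> : ~~ (edge_row p [set v; x] <= lspan (edge_row p) (F :|: star v N'))%MS.
  by rewrite ltnS IHn // -ltnS -cN.
apply/negP => /lspan_comb [a Da].
have dis : [disjoint F & star v N'].
  rewrite -setI_eq0; apply/eqP/setP => e; rewrite !inE.
  apply/negP => /andP[eF /imsetP [y _ Ee]].
  by have := vF _ eF; rewrite Ee !inE eqxx.
have injS : {in N' &, injective (fun y => [set v; y])}.
  move=> y z yN' zN' /setP/(_ y); rewrite !inE eqxx orbT.
  by rewrite [y == v]eq_sym (negPf (vx _ _)) ?(subsetP sN'N) //= => /esym/eqP.
pose b z := if z == x then 1 else - a [set v; z].
suff : b x = 0 by rewrite /b eqxx => /eqP; rewrite oner_eq0.
apply: indN => // i; have /matrixP/(_ 0 (enum_rank (v, i))) := Da.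
rewrite edge_rowE ?vx // eqxx (negPf (vx _ xN)) mul1r mul0r addr0.
rewrite summxE (big_setID F) /= (_ : _ :&: F = F); last first.
  by apply/setIidPr; rewrite subsetUl.
rewrite big1 ?add0r; last first.
  by move=> e eF; rewrite !mxE enum_rankK /= (negPf (vF _ eF)) mulr0.
rewrite setDUl setDv set0U (_ : _ :\: F = star v N'); last first.
  by apply/setDidPl; rewrite disjoint_sym.
rewrite big_imset //= => D.
have bx : b x = 1 by rewrite /b eqxx.
rewrite NE big_setU1 //= bx mul1r D -big_split big1 // => z zN' /=.
rewrite mxE edge_rowE ?vx ?(subsetP sN'N) // eqxx.
rewrite (negPf (vx _ _)) ?(subsetP sN'N) // mul1r mul0r addr0 /b.
by case: eqP zN' xN' => [-> ->|_ _ _] //; ring.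
Qed.

End EdgeRows.

Section Generic.
Variables (R : realType) (V : finType) (d : nat).
Implicit Types (p q : realization R V d) (E F : {set {set V}}) (u v w x y : V).

Let N := #|{: V * 'I_d}|.

Lemma eval_atB p : {morph eval_at p : P Q / P - Q}.
Proof. by move=> P Q; rewrite /eval_at rmorphB mevalB. Qed.

Lemma eval_atD p : {morph eval_at p : P Q / P + Q}.
Proof. by move=> P Q; rewrite /eval_at rmorphD mevalD. Qed.

Lemma eval_at0 p : eval_at p 0 = 0.
Proof. by rewrite /eval_at rmorph0 meval0. Qed.

Lemma eval_at1 p : eval_at p 1 = 1.
Proof. by rewrite /eval_at rmorph1 meval1. Qed.

Lemma eval_atX p x (i : 'I_d) : eval_at p 'X_(enum_rank (x, i)) = p x 0 i.
Proof. by rewrite /eval_at map_mpolyX mevalXU /coordinates enum_rankK. Qed.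

(** Affine independence means that the coordinate matrix, extended by a column of ones, has
    independent rows. Its entries are polynomials, so by [generic_rank_max] one affinely independent
    placement suffices. *)
Lemma generic_aff_indep p (S : {set V}) :
  generic p -> (#|S| <= d.+1)%N -> aff_indep p S.
Proof.
move=> gp Sd.
pose Q : 'M[{mpoly rat[N]}]_(#|S|, d.+1) := \matrix_(a, j)
  if unlift ord0 j is Some i then 'X_(enum_rank (enum_val a, i)) else 1.
have QE q a j : map_mx (eval_at q) Q a j =
    if unlift ord0 j is Some i then q (enum_val a) 0 i else 1.
  by rewrite !mxE; case: unlift => [i|]; rewrite ?eval_at1 ?eval_atX.
have free q : aff_indep q S <-> row_free (map_mx (eval_at q) Q).
  split=> [ind|free a a0 ap x xS].
    apply: inj_row_free => c cQ.
    pose a x := \sum_(e < #|S|) c 0 e * (x == enum_val e)%:R.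
    have aE e : a (enum_val e) = c 0 e.
      rewrite /a (bigD1 e) //= eqxx mulr1 big1 ?addr0 // => f fe.
      by rewrite (inj_eq enum_val_inj) eq_sym (negPf fe) mulr0.
    apply/rowP => e; rewrite [RHS]mxE -aE; apply: ind; last exact: enum_valP.
      rewrite big_enum_val; have /rowP/(_ ord0) := cQ; rewrite !mxE => H.
      by apply: etrans H; apply: eq_bigr => f _; rewrite aE QE unlift_none mulr1.
    move=> i; rewrite big_enum_val; have /rowP/(_ (lift ord0 i)) := cQ.
    rewrite !mxE => H.
    by apply: etrans H; apply: eq_bigr => f _; rewrite aE QE liftK.
  pose c : 'rV_#|S| := \row_e a (enum_val e).
  have c0 : c = 0.
    apply/eqP; rewrite -(mulmx_free_eq0 c free); apply/eqP/rowP => j.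
    rewrite [RHS]mxE mxE; case: (unliftP ord0 j) => [i|] ->.
      apply: etrans (ap i); rewrite [RHS]big_enum_val.
      by apply: eq_bigr => e _; rewrite QE liftK mxE.
    apply: etrans a0; rewrite [RHS]big_enum_val.
    by apply: eq_bigr => e _; rewrite QE unlift_none mxE mulr1.
  by have /rowP/(_ (enum_rank_in xS x)) := c0; rewrite !mxE enum_rankK_in.
apply/free; rewrite /row_free eqn_leq rank_leq_row /=.
(* The first [d] vertices of [S] go to the unit vectors, and a further one to the origin. *)
pose q : realization R V d := [ffun x => \row_i (index x (enum S) == i)%:R].
apply: leq_trans (generic_rank_max q Q gp).
suff /free : aff_indep q S by rewrite /row_free => /eqP ->.
have inj y z : y \in S -> z \in S -> index y (enum S) = index z (enum S) -> y = z.
  move=> yS zS E; rewrite -[LHS](@nth_index _ y y (enum S)) ?mem_enum // E.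
  by rewrite nth_index ?mem_enum.
have idx y : y \in S -> (index y (enum S) < d.+1)%N.
  by move=> yS; apply: leq_trans Sd; rewrite cardE index_mem mem_enum.
move=> a a0 aq; have low y : y \in S -> (index y (enum S) < d)%N -> a y = 0.
  move=> yS lty; have := aq (Ordinal lty); rewrite (big_setD1 y) //= big1; last first.
    move=> z /setD1P [zy zS]; rewrite ffunE mxE /=; case: eqP => [E|]; last by rewrite mulr0.
    by case/eqP: zy; apply: inj E.
  by rewrite ffunE mxE eqxx mulr1 addr0.
move=> x xS; have [|lex] := ltnP (index x (enum S)) d; first exact: low.
have := a0; rewrite (big_setD1 x) //= big1 ?addr0 // => z /setD1P [zx zS].
apply: low => //; rewrite ltn_neqAle -ltnS idx // andbT.
apply: contra zx => /eqP Ez; apply/eqP; apply: inj => //.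
by have := idx _ xS; rewrite Ez; lia.
Qed.

Definition edge_matrix E : 'M[{mpoly rat[N]}]_(#|E|, N) :=
  \matrix_(a < #|E|, b < N)
    let e : {set V} := enum_val a in
    let w : V := (enum_val b).1 in
    let i : 'I_d := (enum_val b).2 in
    if w \in e then \sum_(x in e) ('X_(enum_rank (w, i)) - 'X_(enum_rank (x, i)))
    else 0.

Lemma generic_lrank_max p q E : generic p ->
  (lrank (edge_row q) E <= lrank (edge_row p) E)%N.
Proof.
move=> gp; have := generic_rank_max q (edge_matrix E) gp.
have Eq (s : realization R V d) : map_mx (eval_at s) (edge_matrix E) = rigidity_matrix E s.
  apply/matrixP => a b; rewrite !mxE /=; case: ifP => _; last exact: eval_at0.
  rewrite (big_morph _ (eval_atD s) (eval_at0 s)); apply: eq_bigr => x _.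
  by rewrite eval_atB !eval_atX.
by rewrite !Eq !rank_rigidity_matrix.
Qed.

Lemma edge_row_eq p q (e : {set V}) :
  {in e, p =1 q} -> edge_row p e = edge_row q e.
Proof.
move=> pq; apply/rowP => b; rewrite !mxE; case: ifP => // be.
by apply: eq_bigr => x xe; rewrite !pq.
Qed.

Lemma eq_lrank p q F : (forall e, e \in F -> {in e, p =1 q}) ->
  lrank (edge_row p) F = lrank (edge_row q) F.
Proof.
by move=> pq; rewrite /lrank /lspan; congr (\rank _); apply: eq_bigr => e eF;
   rewrite (edge_row_eq (pq e eF)).
Qed.

Lemma generic_lrank_star p v F (M : {set V}) : generic p ->
  (forall e, e \in F -> v \notin e) -> v \notin M -> (#|M| <= d)%N ->
  (lrank (edge_row p) F + #|M| <= lrank (edge_row p) (F :|: star v M))%N.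
Proof.
move=> gp vF vM Md; apply: lrank_star => //; apply: aff_indep_diff => //.
by apply: generic_aff_indep => //; rewrite cardsU1 vM.
Qed.

(* Placing v at the midpoint of xy makes the rows of vx and vy span that of
   xy; the remaining edges at v then still contribute d to the rank. *)
Lemma generic_lrank_extension p v F (M : {set V}) x y : generic p ->
  (forall e, e \in F -> v \notin e) -> v \notin M -> #|M| = d.+1 ->
  x \in M -> y \in M -> x != y ->
  (lrank (edge_row p) F < lrank (edge_row p) ([set x; y] |: F))%N ->
  (lrank (edge_row p) F + d.+1 <= lrank (edge_row p) (F :|: star v M))%N.
Proof.
move=> gp vF vM Md xM yM xy ltF.
pose q : realization R V d := [ffun w => if w == v then 2^-1 *: (p x + p y) else p w].
have qM w : w != v -> q w = p w by rewrite ffunE => /negPf ->.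
have Mv w : w \in M -> w != v by apply: contraTneq => ->.
have qv i : q v 0 i = 2^-1 * (p x 0 i + p y 0 i) by rewrite ffunE eqxx !mxE.
apply: leq_trans (generic_lrank_max q _ gp).
pose M1 := M :\ y.
have cM1 : #|M1| = d by apply: succn_inj; rewrite -Md (cardsD1 y M) yM.
have vM1 : v \notin M1 by rewrite inE (negPf vM) andbF.
have rxy : lrank (edge_row q) ([set x; y] |: F) = lrank (edge_row p) ([set x; y] |: F).
  apply: eq_lrank => e /setU1P [->|eF] w.
    by rewrite !inE => /orP[] /eqP ->; rewrite qM ?Mv.
  by move=> we; rewrite qM //; apply: contraTneq we => ->; apply: vF.
have xM1 : x \in M1 by rewrite !inE xy.
(* The edge [xy] takes the place of [vy]: it raises the rank of [F] by 1, and the [d] edges from [v]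
   to [M1] contribute the rest. *)
apply: (@leq_trans (lrank (edge_row q) (([set x; y] |: F) :|: star v M1))).
  apply: (@leq_trans (lrank (edge_row q) ([set x; y] |: F) + #|M1|)%N).
    by rewrite cM1 rxy; lia.
  apply: lrank_star => //.
    move=> e /setU1P [->|/vF //].
    by rewrite !inE ![v == _]eq_sym (negPf (Mv _ xM)) (negPf (Mv _ yM)).
  move=> a Ha z zM1.
  (* Since [q v] is the midpoint of [xy], a dependence [a] of the directions from [v] turns into an
     affine dependence [b] of the [d + 1] generic points of [M]: [A / 2] at [x] and at [y], minus
     [a] on [M1]. Hence [b] vanishes. *)
  pose A := \sum_(w in M1) a w.
  pose b w := (w \in [set x; y])%:R * 2^-1 * A - (w \in M1)%:R * a w.
  have bE w : w \in M1 -> w != x -> b w = - a w.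
    move=> wM1 wx; rewrite /b wM1 !inE (negPf wx).
    by case/setD1P: wM1 => /negPf -> _; rewrite !mul0r mul1r sub0r.
  have bx : b x = 2^-1 * A - a x by rewrite /b xM1 !inE eqxx /= !mul1r.
  have byy : b y = 2^-1 * A by rewrite /b [y \in M1]inE !inE eqxx orbT !mul1r mul0r subr0.
  have sumM (f : V -> R) : \sum_(w in M) b w * f w =
      2^-1 * A * (f x + f y) - \sum_(w in M1) a w * f w.
    rewrite (big_setD1 y) //= byy (big_setD1 x) //= bx.
    rewrite (eq_bigr (fun w => - (a w * f w))); last first.
      by move=> w /setD1P [wx wM1]; rewrite bE // mulNr.
    rewrite [in RHS](big_setD1 x) //= sumrN; ring.
  have b0 w : w \in M -> b w = 0.
    apply: (generic_aff_indep gp) => [||i]; first by rewrite Md.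
      have := sumM (fun=> 1); rewrite (eq_bigr b) => [->|u _]; last by rewrite mulr1.
      by rewrite (eq_bigr a) => [|u _]; rewrite ?mulr1 // -/A; field.
    rewrite sumM (_ : _ * _ * _ = A * q v 0 i); last by rewrite qv; ring.
    rewrite mulr_suml -sumrB; apply: etrans (Ha i).
    apply: eq_bigr => u /setD1P [_ uM]; rewrite (qM u) ?Mv //; ring.
  have [zx|zx] := eqVneq z x; last first.
    by apply: oppr_inj; rewrite -bE // b0 ?oppr0 //; case/setD1P: zM1.
  have A0 : A = 0.
    have := b0 _ yM; rewrite byy => /eqP.
    by rewrite mulf_eq0 invr_eq0 pnatr_eq0 /= => /eqP.
  by have := b0 _ xM; rewrite bx A0 mulr0 sub0r zx => /eqP; rewrite oppr_eq0 => /eqP.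
apply: lrank_le => e /setUP [/setU1P [->|eF]|/imsetP [z /setD1P [_ zM] ->]]; last 2 first.
- by apply: mem_lspan; rewrite inE eF.
- by apply: mem_lspan; rewrite inE [_ \in star _ _]imset_f ?orbT.
apply/lspan_dual => c Hc.
have mid z : z \in M ->
    \sum_i (q v 0 i - q z 0 i) * (c (enum_rank (v, i)) 0 - c (enum_rank (z, i)) 0) = 0.
  move=> zM; apply/edge_row_mul0; first by rewrite eq_sym Mv.
  by apply: Hc; rewrite inE [_ \in star _ _]imset_f ?orbT.
apply/edge_row_mul0 => //; have := mid y yM; have := mid x xM => Hx Hy.
rewrite -[RHS](mulr0 2) -[in RHS](addr0 0).
rewrite -[X in _ * (X + _)]Hx -[X in _ * (_ + X)]Hy -big_split mulr_sumr.
apply: eq_bigr => i _ /=; rewrite qv (qM x) ?Mv // (qM y) ?Mv //; by field.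
Qed.

(** Translating [A] along a coordinate in which [p x] and [p y] differ is an infinitesimal motion of
    [F] that does not preserve the length of [xy]. *)
Lemma cut_lspan p F (A : {set V}) x y : (0 < d)%N -> generic p ->
  (forall e, e \in F -> #|e| = 2%N) ->
  (forall u w, [set u; w] \in F -> u \in A -> w \in A) ->
  x \in A -> y \notin A -> ~~ (edge_row p [set x; y] <= lspan (edge_row p) F)%MS.
Proof.
move=> d0 gp F2 Fcut xA yA; apply/negP => /lspan_dual.
have xy : x != y by apply: contraNneq yA => <-.
have [i0 pi0] : exists i0, p x 0 i0 != p y 0 i0.
  apply/existsP/contraT; rewrite negb_exists => /forallP pE.
  pose a z : R := if z == x then 1 else - 1.
  have sumE (f : V -> R) : \sum_(z in [set x; y]) a z * f z = f x - f y.
    rewrite big_setU1 ?inE //= big_set1 /a eqxx eq_sym (negPf xy).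
    by rewrite mul1r mulN1r.
  suff : a x = 0 by rewrite /a eqxx => /eqP; rewrite oner_eq0.
  apply: (generic_aff_indep (S := [set x; y]) gp); rewrite ?cards2 ?xy ?inE ?eqxx //.
    rewrite -[RHS](subrr 1) -(sumE (fun=> 1)).
    by apply: eq_bigr => z _; rewrite mulr1.
  by move=> i; rewrite sumE; apply/eqP; rewrite subr_eq0; apply/negPn/pE.
pose c : 'cV[R]_N := \col_b (((enum_val b).1 \in A) && ((enum_val b).2 == i0))%:R.
have cE w i : c (enum_rank (w, i)) 0 = ((w \in A) && (i == i0))%:R by rewrite mxE enum_rankK.
have cF f : f \in F -> edge_row p f *m c = 0.
  move=> fF; have /eqP/cards2P [u [w [uw Df]]] := F2 _ fF.
  rewrite Df in fF *; apply/edge_row_mul0 => //; apply: big1 => i _; rewrite !cE.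
  suff -> : (u \in A) = (w \in A) by rewrite subrr mulr0.
  by apply/idP/idP; [apply: Fcut|apply: Fcut; rewrite setUC].
move/(_ _ cF)/edge_row_mul0 => /(_ xy); rewrite (bigD1 i0) //= !cE xA (negPf yA) eqxx.
rewrite big1; last by move=> i /negPf ii0; rewrite !cE ii0 !andbF subrr mulr0.
by rewrite addr0 subr0 mulr1 => /eqP; rewrite subr_eq0 (negPf pi0).
Qed.

(* For the affine dependency lambda of d + 2 points, the products
   lambda_x lambda_y form an equilibrium stress. *)
Lemma stress_lspan p F (M : {set V}) x y : generic p -> #|M| = d ->
  x \notin M -> y \notin M -> x != y ->
  (forall u w, u != w -> u \in [set x; y] :|: M -> w \in [set x; y] :|: M ->
     [set u; w] != [set x; y] -> [set u; w] \in F) ->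
  (edge_row p [set x; y] <= lspan (edge_row p) F)%MS.
Proof.
move=> gp cM xM yM xy KF; pose S := [set x; y] :|: M.
have cS : #|S| = d.+2.
  rewrite cardsU cards2 xy cM (_ : _ :&: _ = set0) ?cards0 ?subn0 ?add2n //.
  by apply/eqP; rewrite setI_eq0 disjoints_subset subUset !sub1set !inE xM yM.
have [a [a0 aS [z zS az]]] : exists a : V -> R, [/\ \sum_(w in S) a w = 0,
    forall i, \sum_(w in S) a w * p w 0 i = 0 & exists2 z, z \in S & a z != 0].
  pose Q : 'M[R]_(#|S|, d.+1) := \matrix_(e, j)
    if unlift ord0 j is Some i then p (enum_val e) 0 i else 1.
  have : kermx Q != 0.
    rewrite -mxrank_eq0 mxrank_ker subn_eq0 -ltnNge.
    by apply: leq_ltn_trans (rank_leq_col _) _; rewrite cS.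
  case/rowV0Pn => c /sub_kermxP cQ c0.
  pose a x := \sum_(e < #|S|) c 0 e * (x == enum_val e)%:R.
  have aE e : a (enum_val e) = c 0 e.
    rewrite /a (bigD1 e) //= eqxx mulr1 big1 ?addr0 // => f fe.
    by rewrite (inj_eq enum_val_inj) eq_sym (negPf fe) mulr0.
  exists a; split.
  - rewrite big_enum_val; have /rowP/(_ ord0) := cQ; rewrite !mxE => H.
    by apply: etrans H; apply: eq_bigr => f _; rewrite aE mxE unlift_none mulr1.
  - move=> i; rewrite big_enum_val; have /rowP/(_ (lift ord0 i)) := cQ.
    by rewrite !mxE => H; apply: etrans H; apply: eq_bigr => f _; rewrite aE mxE liftK.
  case/rV0Pn: c0 => e ce; exists (enum_val e); first exact: enum_valP.
  by rewrite aE.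
(* Any [d + 1] of the points are affinely independent, so the dependency involves all of them. *)
have nz u : u \in S -> a u != 0.
  move=> uS; apply: contraNneq az => au; apply/eqP.
  have [->//|zu] := eqVneq z u.
  apply: (generic_aff_indep (S := S :\ u) gp); last by rewrite in_setD1 zu.
  - by have := cardsD1 u S; rewrite uS cS; lia.
  - by move: a0; rewrite (big_setD1 u) //= au add0r.
  - by move=> i; move: (aS i); rewrite (big_setD1 u) //= au mul0r add0r.
have xS : x \in S by rewrite !inE eqxx.
have yS : y \in S by rewrite !inE eqxx orbT.
apply/lspan_dual => c Hc; apply/edge_row_mul0 => //.
pose m u i := c (enum_rank (u, i)) 0.
pose f u w := \sum_i (p u 0 i - p w 0 i) * (m u i - m w i).
rewrite -[LHS]/(f x y).
have fC u w : f u w = f w u by rewrite /f; apply: eq_bigr => i _; ring.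
have fuu u : f u u = 0 by rewrite /f; apply: big1 => i _; rewrite subrr mul0r.
have f0 u w : u \in S -> w \in S -> [set u; w] != [set x; y] -> f u w = 0.
  move=> uS wS uwxy; have [->|uw] := eqVneq u w; first exact: fuu.
  by apply/edge_row_mul0 => //; apply: Hc; apply: KF.
(* Expanded in each coordinate, every term has a factor that is one of the vanishing sums of the
   dependency. Since [f] is zero on all pairs except [xy], only [2 * a x * a y * f x y] remains of
   the sum. *)
have tot : \sum_(u in S) \sum_(w in S) a u * a w * f u w = 0.
  have -> : \sum_(u in S) \sum_(w in S) a u * a w * f u w =
      \sum_i \sum_(u in S) \sum_(w in S)
        a u * a w * ((p u 0 i - p w 0 i) * (m u i - m w i)).
    rewrite [RHS]exchange_big; apply: eq_bigr => u _ /=.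
    rewrite [RHS]exchange_big; apply: eq_bigr => w _ /=.
    by rewrite mulr_sumr.
  apply: big1 => i _.
  have -> : \sum_(u in S) \sum_(w in S)
        a u * a w * ((p u 0 i - p w 0 i) * (m u i - m w i)) =
      2 * (\sum_(u in S) a u * p u 0 i * m u i) * (\sum_(w in S) a w)
      - 2 * (\sum_(u in S) a u * p u 0 i) * (\sum_(w in S) a w * m w i).
    have E (g h : V -> R) : (\sum_(u in S) g u) * (\sum_(w in S) h w) =
        \sum_(u in S) \sum_(w in S) g u * h w.
      by rewrite mulr_suml; apply: eq_bigr => u _; rewrite mulr_sumr.
    have E' (g h : V -> R) : (\sum_(u in S) g u) * (\sum_(w in S) h w) =
        \sum_(u in S) \sum_(w in S) g w * h u.
      by rewrite E exchange_big.
    rewrite (_ : forall A B C D : R,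
        2 * A * B - 2 * C * D = A * B + A * B - (C * D + C * D));
      last by move=> *; ring.
    rewrite [X in X + _ - _]E [X in _ + X - _]E' [X in _ - (X + _)]E [X in _ - (_ + X)]E'.
    rewrite -!big_split -sumrB; apply: eq_bigr => u _ /=.
    rewrite -!big_split -sumrB; apply: eq_bigr => w _ /=; ring.
  by rewrite a0 aS mulr0 mulr0 mul0r subrr.
have row0 u : u \in S -> u != x -> u != y -> \sum_(w in S) a u * a w * f u w = 0.
  move=> uS ux uy; apply: big1 => w wS; rewrite f0 ?mulr0 //.
  apply: contraNneq ux => /setP/(_ u); rewrite !inE eqxx (negPf uy) orbF /=.
  by move=> /esym.
have rowx : \sum_(w in S) a x * a w * f x w = a x * a y * f x y.
  rewrite (bigD1 y) //= big1 ?addr0 // => w /andP[wS wy]; rewrite f0 ?mulr0 //.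
  apply: contraNneq wy => /setP/(_ y); rewrite !inE eqxx orbT.
  by rewrite ![y == _]eq_sym (negPf xy) eq_sym.
have rowy : \sum_(w in S) a y * a w * f y w = a y * a x * f y x.
  rewrite (bigD1 x) //= big1 ?addr0 // => w /andP[wS wx]; rewrite f0 ?mulr0 //.
  apply: contraNneq wx => /setP/(_ x); rewrite !inE eqxx orTb (negPf xy).
  by rewrite eq_sym.
move: tot; rewrite (bigD1 x) //= rowx (bigD1 y) /=; last by rewrite yS eq_sym.
rewrite rowy big1 ?addr0; last first.
  by move=> u /andP[/andP[uS ux] uy]; apply: row0.
rewrite (fC y x) => /eqP.
rewrite (_ : _ + _ = 2 * a x * a y * f x y); last by ring.
by rewrite !mulf_eq0 pnatr_eq0 (negPf (nz _ xS)) (negPf (nz _ yS)) => /eqP.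
Qed.

End Generic.

(** * The axioms for the generic rigidity matroid, and the conclusion *)

Lemma rigidity_rank_axioms (R : realType) (V : finType) (d : nat) : (0 < d)%N ->
  @rigidity_axioms V d (rigidity_rank R d).
Proof.
move=> d_gt0; have gp := @generic_realizationP R V d.
have -> : @rigidity_rank R V d = lrank (edge_row (generic_realization R V d)).
  by apply/boolp.funext => E; apply: rank_rigidity_matrix.
split.
- exact: lrankS.
- exact: lrank_submod.
- exact: lrank_card.
- by move=> F v M; apply: generic_lrank_star.
- by move=> F v M x y; apply: generic_lrank_extension.
- by move=> F M x y cM xM yM xy KF; rewrite lrankU1 (stress_lspan gp cM xM yM xy KF).
move=> F A x y F2 cutF xA yA.
by rewrite lrankU1 (cut_lspan d_gt0 gp F2 cutF xA yA).
Qed.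

Theorem corollary1p5 (R : realType) (r : nat) (r_gt0 : (0 < r)%N) :
  (forall d : nat, (2 <= d)%N ->
     (forall (V : finType) (E : {set {set V}}),
        simple_graph E ->
        k_connected (d * (d + 1) + 2 * r)%N E ->
        has_rigid_tree_packing R d r E) /\
     (exists (V : finType) (E : {set {set V}}),
        [/\ simple_graph E,
            k_connected (d * (d + 1) + 2 * r - 1)%N E
          & ~ has_rigid_tree_packing R d r E])) /\
  (forall k : nat, (0 < k)%N ->
     forall (V : finType) (E : {set {set V}}),
       simple_graph E ->
       k_connected (k * (k + 1) + 2 * r)%N E ->
       exists T : 'I_r -> {set {set V}},
         disjoint_spanning_trees E T /\
         k_connected k (E :\: \bigcup_(i < r) T i)).
Proof.
have ax V d d_gt0 := @rigidity_rank_axioms R V d d_gt0.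
split=> [d d_gt1|k k_gt0 V E simE connE]; last first.
  have [H [T [HE rigH treeT disH]]] :=
    rigid_tree_packing (ax V k k_gt0) (ax V 1%N isT) k_gt0 simE connE.
  (* The graph without the trees contains the rigid graph [H], and adding edges keeps it
     [k]-connected. *)
  exists T; split=> //; apply: (@k_connectedS _ _ H).
    apply/subsetP => e eH; rewrite inE (subsetP HE) // andbT.
    by apply/bigcupP => [[i _]]; apply/negP; rewrite (disjointFr (disH i)).
  apply: rigid_k_connected (ax V k k_gt0) _ _ rigH.
    by have [Vbig _] := connE; apply: leq_trans Vbig; nia.
  by apply/subsetP => e /(subsetP HE) /simE e2; rewrite inE e2.
have d_gt0 : (0 < d)%N by apply: ltnW.
split=> [V E simE connE|].
  exact: (rigid_tree_packing (ax V d d_gt0) (ax V 1%N isT) d_gt0 simE connE).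
pose m := (d * (d + 1) + 2 * r - 1)%N.
have mE : m.+1 = (d * (d + 1) + 2 * r)%N.
  by rewrite /m subn1 prednK // addn_gt0 muln_gt0 d_gt0 addn1.
exists (bool * ('I_m * 'I_m))%type, (replaced_edges m); split.
- exact: replaced_simple.
- apply: replaced_connected; rewrite -ltnS mE; nia.
exact: replaced_no_packing (ax _ d d_gt0) (ax _ 1%N isT) mE d_gt1.
Qed.
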